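(* Let $n\ge 1$, let $m_n,\dots,m_1$ be nonnegative integers and let $\beta=[m_n,\dots,m_1]$ be the corresponding band dimension vector for the algebra $A(n)$. Then the up-and-down band modules of dimension vector $\beta$ are generic in their component: the union of the $GL(\beta)$-orbits of the modules $M(\beta;\underline\lambda)$ (over all choices of nonzero scalars $\underline\lambda$, one for each connected component of the up-and-down graph $\Gamma(\beta)$) contains a nonempty Zariski open subset of the band module component $R(A(n),\beta)$.
   Context: Let $K$ be a field of characteristic $0$. The quiver $Q(n)$ has vertices $x_n,\dots,x_0$ and arrows $a_i,b_i:x_i\to x_{i-1}$ for $1\le i\le n$. The algebra $A(n)$ is the path algebra $KQ(n)$ modulo the two-sided ideal generated by $a_ia_{i+1}$ and $b_ib_{i+1}$, $1\le i\le n-1$ (composition of maps: $a_{i+1}$ first). A representation of dimension vector $\beta=(\beta_n,\dots,\beta_0)$ consists of spaces $F_i$ with $\dim F_i=\beta_i$ and maps $a_i,b_i:F_i\to F_{i-1}$ with $a_ia_{i+1}=b_ib_{i+1}=0$. The affine variety of these is $\mathrm{Rep}(A(n),\beta)$, with the natural action of $GL(\beta)=\prod_i GL(\beta_i)$. Put $m_0=m_{n+1}=0$. The band dimension vector $\beta=[m_n,\dots,m_1]$ is $\beta_i=m_i+m_{i+1}$, $0\le i\le n$, i.e. $\beta=(m_n,m_n+m_{n-1},\dots,m_2+m_1,m_1)$. The band module component is the irreducible component $$R(A(n),\beta)=\{(a_i,b_i)\in \mathrm{Rep}(A(n),\beta): \operatorname{rank}a_i\le m_i,\ \operatorname{rank}b_i\le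 m_i\ \text{for all }i\}.$$ Up-and-down graph $\Gamma(\beta)$: vertices $e^{(i)}_j$, $0\le i\le n$, $1\le j\le\beta_i$. For each $1\le i\le n$ there are $m_i$ ''upper'' edges joining $e^{(i)}_j$ to $e^{(i-1)}_j$ ($1\le j\le m_i$) and $m_i$ ''lower'' edges joining $e^{(i)}_{\beta_i+1-j}$ to $e^{(i-1)}_{\beta_{i-1}+1-j}$ ($1\le j\le m_i$). If $n-i$ is even the upper edges are red and the lower ones blue; if $n-i$ is odd the upper edges are blue and the lower ones red. Every connected component of $\Gamma(\beta)$ is a cycle with edges of alternating colors (possibly a cycle with two vertices and two parallel edges). Up-and-down modules $M(\beta;\underline\lambda)$: $F_i$ has basis $e^{(i)}_1,\dots,e^{(i)}_{\beta_i}$; $a_i$ sends $e^{(i)}_j$ to $e^{(i-1)}_k$ if these are joined by a red edge, and to $0$ if no red edge goes from $e^{(i)}_j$ to level $i-1$; $b_i$ is defined in the same way with blue edges. This is modified by marking one edge in each connected component (the upper edge at the uppermost vertex, i.e. the one with the smallest $j$, of the leftmost level, i.e. the largest $i$, met by that component) and multiplying the corresponding matrix entry by a nonzero scalar; $\underline\lambda$ is the collection of these scalars.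
   Formalization: Modules, scalars and GL(β)-orbits are taken over an algebraically closed extension L of K (L = K allowed), with open sets given by polynomials over K; on K-rational points the claim fails for non-closed K, e.g. K = Q, n = 1, m_1 = 2. *)

(* Defs.v *)
From HB Require Import structures.
From mathcomp Require Import all_boot all_order all_algebra.
From mathcomp Require Import mpoly.

Set Implicit Arguments.
Unset Strict Implicit.
Unset Printing Implicit Defensive.

Import GRing.Theory.
Local Open Scope ring_scope.

(* Arrows are indexed by i : 'I_n: the index i stands for the pair
   a_(i+1), b_(i+1) : x_(i+1) -> x_i.  Matrices act on column vectors, so that
   the matrix of F_(i+1) -> F_i has beta i rows and beta i.+1 columns and
   composition of maps is *m.  Only the values beta 0, ..., beta n matter. *)
Record quiver_rep (F : Type) (n : nat) (beta : nat -> nat) := QuiverRep {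
  mapa : forall i : 'I_n, 'M[F]_(beta i, beta i.+1);
  mapb : forall i : 'I_n, 'M[F]_(beta i, beta i.+1)
}.

Definition in_Rep (F : fieldType) (n : nat) (beta : nat -> nat)
    (x : quiver_rep F n beta) : Prop :=
  forall (i : nat) (h : (i.+1 < n)%N),
    mapa x (Ordinal (ltnW h)) *m mapa x (Ordinal h) = 0 /\
    mapb x (Ordinal (ltnW h)) *m mapb x (Ordinal h) = 0.

Definition same_GL_orbit (F : fieldType) (n : nat) (beta : nat -> nat)
    (x y : quiver_rep F n beta) : Prop :=
  exists g : forall i : nat, 'M[F]_(beta i),
    (forall i, (i <= n)%N -> g i \in unitmx) /\
    (forall i : 'I_n,
       mapa y i = g i *m mapa x i *m invmx (g i.+1) /\
       mapb y i = g i *m mapb x i *m invmx (g i.+1)).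

(* The coordinates of the affine space of pairs of families of matrices:
   (true, (i, (r, s))) is the (r, s) entry of the a-arrow of index i, and
   (false, (i, (r, s))) that of the b-arrow. *)
Definition coord (n : nat) (beta : nat -> nat) : finType :=
  (bool * {i : 'I_n & 'I_(beta i) * 'I_(beta i.+1)})%type.

Definition coord_val (F : Type) (n : nat) (beta : nat -> nat)
    (x : quiver_rep F n beta) (c : coord n beta) : F :=
  let r := (tagged c.2).1 in
  let s := (tagged c.2).2 in
  if c.1 then mapa x (tag c.2) r s else mapb x (tag c.2) r s.

(* A variety over K is described by its points over an algebraically closed
   extension iota : K -> L; its Zariski topology is the one given by polynomials
   with coefficients in K.  Taking iota to be the identity of an algebraically
   closed field gives the classical notions. *)
Definition poly_eval (K L : fieldType) (iota : {rmorphism K -> L}) (n : nat)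
    (beta : nat -> nat) (p : {mpoly K[#|coord n beta|]})
    (x : quiver_rep L n beta) : L :=
  (map_mpoly iota p).@[fun k => coord_val x (enum_val k)].

Definition zariski_open_in (K L : fieldType) (iota : {rmorphism K -> L})
    (n : nat) (beta : nat -> nat) (X U : quiver_rep L n beta -> Prop) : Prop :=
  exists S : {mpoly K[#|coord n beta|]} -> Prop,
    forall x, U x <-> X x /\ exists2 p, S p & poly_eval iota p x != 0.

Definition band_dim (m : nat -> nat) (i : nat) : nat := (m i + m i.+1)%N.

Definition band_component (F : fieldType) (n : nat) (m : nat -> nat)
    (x : quiver_rep F n (band_dim m)) : Prop :=
  in_Rep x /\
  forall i : 'I_n, (\rank (mapa x i) <= m i.+1)%N /\
                   (\rank (mapb x i) <= m i.+1)%N.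

Section UpAndDown.
Variables (n : nat) (m : nat -> nat).
Local Notation beta := (band_dim m).

(* The vertex (i, j) is e^(i)_(j+1): positions in a level are counted from 0. *)
Definition vertex : finType := {i : 'I_n.+1 & 'I_(beta i)}.
Definition level (u : vertex) : nat := tag u.
Definition pos (u : vertex) : nat := tagged u.
(* 0-based position counted from the bottom of the level *)
Definition copos (u : vertex) : nat := rev_ord (tagged u).

(* Both relations are oriented from level i to level i-1. *)
Definition upper_edge : rel vertex := fun u v =>
  [&& level u == (level v).+1, pos u == pos v & (pos u < m (level u))%N].
Definition lower_edge : rel vertex := fun u v =>
  [&& level u == (level v).+1, copos u == copos v & (copos u < m (level u))%N].

Definition adjacent : rel vertex := fun u v =>
  [|| upper_edge u v, lower_edge u v, upper_edge v u | lower_edge v u].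

(* The uppermost vertex of the leftmost level of its connected component; each
   component contains exactly one, and the marked edge is its upper edge. *)
Definition marked : pred vertex := fun u =>
  [forall v, connect adjacent u v ==>
     (level v < level u)%N || (level v == level u) && (pos u <= pos v)%N].

Definition source_vertex (i : 'I_n) (s : 'I_(beta i.+1)) : vertex :=
  Tagged (fun k : 'I_n.+1 => 'I_(beta k)) (s : 'I_(beta (lift ord0 i))).
Definition target_vertex (i : 'I_n) (r : 'I_(beta i)) : vertex :=
  Tagged (fun k : 'I_n.+1 => 'I_(beta k))
    (r : 'I_(beta (widen_ord (leqnSn n) i))).

Variables (F : fieldType) (lambda : vertex -> F).

Definition upper_mx (i : 'I_n) : 'M[F]_(beta i, beta i.+1) :=
  \matrix_(r, s)
    let u := source_vertex s in
    if upper_edge u (target_vertex r) then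
      if marked u then lambda u else 1
    else 0.
Definition lower_mx (i : 'I_n) : 'M[F]_(beta i, beta i.+1) :=
  \matrix_(r, s)
    if lower_edge (source_vertex s) (target_vertex r) then 1 else 0.

(* M(beta; lambda): the arrows from level i+1 to level i have red upper edges
   exactly when n - (i+1) is even, and a, b are given by the red, blue edges. *)
Definition up_and_down_module : quiver_rep F n beta :=
  QuiverRep
    (fun i => if odd (n - i.+1) then lower_mx i else upper_mx i)
    (fun i => if odd (n - i.+1) then upper_mx i else lower_mx i).

End UpAndDown.

(* The scalar of a connected component is the value of lambda at its marked
   vertex; the other values of lambda are irrelevant. *)
Definition up_and_down_scalars (n : nat) (m : nat -> nat) (F : fieldType)
    (lambda : vertex n m -> F) : Prop :=
  forall u, marked u -> lambda u != 0.

(* Main.v *)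
Require Import Defs.
From HB Require Import structures.
From mathcomp Require Import all_boot all_order all_algebra.
From mathcomp Require Import mpoly.
From mathcomp Require Import fingroup perm zify ring.

(* Write u and d for the maps given by the upper and the lower arrows, so that
   u d = d u = 0.  Following an upper edge to the left (u^-1) from a vertex that
   has one, and the lower edge to the right (d) from the other vertices, is a
   permutation of the vertices whose orbits are the components of Gamma.  A
   vector with a chain of u^-1 and d along the itinerary of a vertex p is a
   partial homomorphism from a string module, and a chain that closes up to a
   scalar tau is a homomorphism from the band module of the orbit of p.  Such
   homomorphisms form the kernel of a square matrix J_p(x, tau), polynomial in
   x and tau.  The open set is given by det J_p(x, 1) <> 0 and by the
   condition that det J_p(x, tau) has at least r distinct nonzero roots in
   tau, where r is the number of vertices whose itinerary is that of p
   ("parallel" vertices); both conditions are nonvanishing conditions on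
   polynomials in x with coefficients in K.

   They hold at a module with suitable scalars on its components: the coordinate
   of a homomorphism at a pair of vertices w, q of the same level is carried
   along by the walk, and vanishes where w and q leave a common itinerary, so
   only parallel pairs survive.

   Conversely, det J_p(x, 1) <> 0 implies that a chain starting at 0 is 0, and
   that a chain of finite length preceded by enough turns is 0.  The roots tau
   provide the vectors of a basis of x adapted to the edges of Gamma.  For
   linear independence: two parallel classes of a level separate at some point,
   where the chain of the upper one is killed by d; thus the contribution of
   the lowest class in a relation is a chain which ends, hence is 0, and inside
   a class the scalars tau are distinct. *)

Set Implicit Arguments.
Unset Strict Implicit.
Unset Printing Implicit Defensive.
Import GRing.Theory.

(* [goes_up w]: the edge followed by the walk out of [w] is the upper edge
   towards the left (level + 1); otherwise it is the lower edge towards the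
   right (level - 1).  Each vertex is entered once and left once. *)
Definition goes_up n m (w : vertex n m) := pos w < m (level w).+1.

HB.lock Definition walk n m (w : vertex n m) : vertex n m :=
  odflt w [pick v | if goes_up w then upper_edge v w else lower_edge w v].
Arguments walk {n m} w.

(** * The walk on the up-and-down graph and parallel vertices *)

Section Combinatorics.
Variables (n : nat) (m : nat -> nat).
Hypotheses (m_0 : m 0 = 0) (m_n1 : m n.+1 = 0).
Local Notation vtx := (vertex n m).
Implicit Types u v w q p : vtx.

Lemma level_le w : level w <= n.
Proof. by rewrite -ltnS; exact: ltn_ord. Qed.

Lemma pos_copos w : pos w + copos w + 1 = m (level w) + m (level w).+1.
Proof.
case: w => i j; rewrite /pos /copos /level /=; have := ltn_ord j.
rewrite /band_dim; lia.
Qed.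

Lemma vertex_inj u v : level u = level v -> pos u = pos v -> u = v.
Proof.
case: u => i j; case: v => i' j'; rewrite /level /pos /= => /val_inj eqi.
by subst i' => /val_inj ->.
Qed.

Lemma vertex_exists i j : i <= n -> j < band_dim m i ->
  exists2 v : vtx, level v = i & pos v = j.
Proof.
move=> le_in lt_j.
by exists (Tagged (fun k : 'I_n.+1 => 'I_(band_dim m k))
             (Ordinal lt_j : 'I_(band_dim m (Ordinal (le_in : i < n.+1))))).
Qed.

Lemma upper_edgeP v w :
  reflect [/\ level v = (level w).+1, pos v = pos w & pos v < m (level v)]
          (upper_edge v w).
Proof.
by apply: (iffP and3P) => [[/eqP ? /eqP ? ?]|[-> -> ?]]; split=> //; apply/eqP.
Qed.

Lemma lower_edgeP v w :
  reflect [/\ level v = (level w).+1, copos v = copos w & copos v < m (level v)]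
          (lower_edge v w).
Proof.
by apply: (iffP and3P) => [[/eqP ? /eqP ? ?]|[-> -> ?]]; split=> //; apply/eqP.
Qed.

(** Both boundary conditions enter here: [m n.+1 = 0] leaves no vertex of level [n] that goes up,
    and [m 0 = 0] forces every vertex of level 0 to go up. Hence the wanted edge always exists and
    the default value of [walk] is never taken. *)
Lemma walk_edge w : if goes_up w then upper_edge (walk w) w else lower_edge w (walk w).
Proof.
rewrite unlock; case: pickP => [v //|/= no_v]; exfalso.
have := pos_copos w; have := level_le w.
case up_w: (goes_up w) no_v => no_v le_w pc_w.
  have lt_w : level w < n.
    rewrite ltn_neqAle le_w andbT; apply/eqP => eq_w.
    by move: up_w; rewrite /goes_up eq_w m_n1.
  have [||v lv pv] := @vertex_exists (level w).+1 (pos w) => //.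
    by rewrite /band_dim; move: up_w; rewrite /goes_up; lia.
  by have /upper_edgeP[] := no_v v; rewrite lv pv.
move/negbT: up_w; rewrite /goes_up -leqNgt => up_w.
have lw_gt0 : 0 < level w.
  by rewrite lt0n; apply/eqP => l0; move: pc_w up_w; rewrite l0 m_0; lia.
have [||v lv pv] := @vertex_exists (level w).-1
    (m (level w).-1 + m (level w) - (copos w).+1).
- by lia.
- by rewrite /band_dim prednK //; lia.
have /lower_edgeP[] := no_v v; have := pos_copos v.
by rewrite lv pv prednK //; split; lia.
Qed.

Lemma upper_walkP w : goes_up w -> level (walk w) = (level w).+1 /\ pos (walk w) = pos w.
Proof. by move=> up_w; have := walk_edge w; rewrite up_w => /upper_edgeP[]. Qed.

Lemma lower_walkP w :
  ~~ goes_up w -> level w = (level (walk w)).+1 /\ copos w = copos (walk w).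
Proof. by move=> /negbTE up_w; have := walk_edge w; rewrite up_w => /lower_edgeP[]. Qed.

(** The kind of edge just followed can also be read off at its end, which is what makes the walk
    injective. *)
Lemma goes_up_walk w : goes_up w = (pos (walk w) < m (level (walk w))).
Proof.
have := walk_edge w; case: ifP => [_ /upper_edgeP[_ _ ->] //|].
move=> dw /lower_edgeP[lw cw ltw]; apply/esym/negbTE.
by have := pos_copos (walk w); rewrite -leqNgt -lw -cw; lia.
Qed.

Lemma upper_edge_walk v w : upper_edge v w = goes_up w && (v == walk w).
Proof.
apply/idP/andP => [/upper_edgeP[lv pv ltv]|[up_w /eqP->]]; last first.
  by have := walk_edge w; rewrite up_w.
have up_w : goes_up w by rewrite /goes_up -lv -pv.
have [ln pn] := upper_walkP up_w.
by split=> //; apply/eqP/vertex_inj; rewrite ?ln ?pn.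
Qed.

Lemma lower_edge_walk v w : lower_edge v w = ~~ goes_up v && (w == walk v).
Proof.
apply/idP/andP => [/lower_edgeP[lv cv ltv]|[/negbTE up_v /eqP->]]; last first.
  by have := walk_edge v; rewrite up_v.
have dv : ~~ goes_up v.
  by have := pos_copos v; rewrite /goes_up; lia.
have [ln cn] := lower_walkP dv.
have lwn : level w = level (walk v) by lia.
split=> //; apply/eqP/vertex_inj => //.
by have := pos_copos w; have := pos_copos (walk v); rewrite -cn cv lwn; lia.
Qed.

(** An upper edge preserves [pos] and a lower edge preserves [copos], so equal moves between the
    same levels preserve the difference of positions. Sums replace differences because subtraction
    on [nat] is truncated. *)
Lemma walk_back u v : goes_up u = goes_up v -> level (walk u) = level (walk v) ->
  level u = level v /\ pos (walk u) + pos v = pos (walk v) + pos u.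
Proof.
move=> uv; case up_u: (goes_up u) (uv) => up_v ln.
  have [? ?] := upper_walkP up_u; have [? ?] := upper_walkP (esym up_v); lia.
have [lu cu] := lower_walkP (negbT up_u).
have [lv cv] := lower_walkP (negbT (esym up_v)).
have luv : level u = level v by lia.
have := pos_copos u; have := pos_copos v.
have := pos_copos (walk u); have := pos_copos (walk v).
by rewrite -cu -cv luv ln; split=> //; lia.
Qed.

Lemma walk_inj : injective (@walk n m).
Proof.
move=> u v uv; have gu : goes_up u = goes_up v by rewrite !goes_up_walk uv.
have [|luv puv] := walk_back gu; first by rewrite uv.
by apply: vertex_inj => //; move: puv; rewrite uv; lia.
Qed.

Lemma walk_level u v : goes_up u = goes_up v -> level u = level v ->
  level (walk u) = level (walk v) /\ pos (walk u) + pos v = pos (walk v) + pos u.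
Proof.
move=> uv luv; suff ln : level (walk u) = level (walk v).
  by split=> //; have [] := walk_back uv ln.
case up_u: (goes_up u) (uv) => up_v.
  by have [-> _] := upper_walkP up_u; have [-> _] := upper_walkP (esym up_v); rewrite luv.
have [lu _] := lower_walkP (negbT up_u).
by have [lv _] := lower_walkP (negbT (esym up_v)); lia.
Qed.

(** Taking the order of the whole permutation makes walks from different vertices return home
    simultaneously. *)
Definition period : nat := #[perm walk_inj]%g.

Lemma period_gt0 : 0 < period. Proof. exact: order_gt0. Qed.

Lemma iter_period w : iter period walk w = w.
Proof.
have := expg_order (perm walk_inj) => /permP/(_ w); rewrite permX perm1 => {2}<-.
by apply: eq_iter => v; rewrite permE.
Qed.

Lemma iter_period_mul k w : iter (k * period) walk w = w.
Proof.
by elim: k => // k IHk; rewrite mulSn iterD IHk iter_period.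
Qed.

Lemma iter_modp k w : iter (k %% period) walk w = iter k walk w.
Proof. by rewrite {2}(divn_eq k period) addnC iterD iter_period_mul. Qed.

(* Parallel vertices: their walks follow the same itinerary for ever. *)
Definition par u v := (level u == level v) &&
  [forall k : 'I_period, goes_up (iter k walk u) == goes_up (iter k walk v)].

Lemma parP u v : reflect (level u = level v /\
  forall k, goes_up (iter k walk u) = goes_up (iter k walk v)) (par u v).
Proof.
apply: (iffP andP) => [[/eqP luv /forallP same]|[luv same]]; split=> //.
- move=> k; rewrite -(iter_modp k u) -(iter_modp k v).
  have lt_k := ltn_pmod k period_gt0; exact: (eqP (same (Ordinal lt_k))).
- exact/eqP.
- by apply/forallP=> k; apply/eqP.
Qed.

Lemma par_refl u : par u u. Proof. exact/parP. Qed.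

Lemma par_sym u v : par u v = par v u.
Proof. by apply/parP/parP => -[l same]; split. Qed.

Lemma par_trans v u w : par u v -> par v w -> par u w.
Proof.
move=> /parP[l1 s1] /parP[l2 s2]; apply/parP.
by split=> [|k]; rewrite ?s1 // l1.
Qed.

Lemma par_level u v : par u v -> level u = level v.
Proof. by case/parP. Qed.

Lemma par_up u v : par u v -> goes_up u = goes_up v.
Proof. by case/parP=> _ /(_ 0). Qed.

Lemma agree_iter u v k : level u = level v ->
  (forall j, j < k -> goes_up (iter j walk u) = goes_up (iter j walk v)) ->
  level (iter k walk u) = level (iter k walk v) /\
  pos (iter k walk u) + pos v = pos (iter k walk v) + pos u.
Proof.
move=> luv; elim: k => [|k IHk] same; first by split=> //=; lia.
have [j lt_jk|lk pk] := IHk; first by apply: same; lia.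
by rewrite !iterS; have [l1 p1] := walk_level (same k (ltnSn k)) lk; lia.
Qed.

Lemma par_iter u v k : par u v -> par (iter k walk u) (iter k walk v).
Proof.
move=> /parP[luv same]; apply/parP; split; last by move=> j; rewrite -!iterD.
by have [] := @agree_iter u v k luv.
Qed.

Lemma par_iterE u v k : par (iter k walk u) (iter k walk v) = par u v.
Proof.
apply/idP/idP => [puv|]; last exact: par_iter.
(* [period * k - k] further steps complete [k] full periods, which brings both walks back to their
   starting vertices. *)
have := @par_iter _ _ (period * k - k) puv; rewrite -!iterD subnK ?leq_pmull ?period_gt0 //.
by rewrite mulnC !iter_period_mul.
Qed.

Lemma par_walk u v : par (walk u) (walk v) = par u v.
Proof. exact: (@par_iterE u v 1). Qed.

Lemma par_pos u v k : par u v ->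
  pos (iter k walk u) + pos v = pos (iter k walk v) + pos u.
Proof. by move=> /parP[luv same]; have [] := @agree_iter u v k luv. Qed.

Lemma par_pos_walk u v : par u v -> pos (walk u) + pos v = pos (walk v) + pos u.
Proof. exact: (@par_pos u v 1). Qed.

(** Parallel walks undergo the same displacement of positions after [k] steps, and it is 0 for the
    first one. *)
Lemma par_return u v k : par u v -> iter k walk u = u -> iter k walk v = v.
Proof.
move=> puv ku; have := par_pos k puv; rewrite ku => pk.
have lk := par_level (par_iter k puv); rewrite ku in lk.
by apply: vertex_inj; [rewrite -lk (par_level puv)|lia].
Qed.

(* A parallel vertex on the same cycle would be translated by a fixed nonzero
   amount each time the cycle is run through, and leave the level. *)
Lemma par_fconnect u v : par u v -> fconnect walk u v -> u = v.
Proof.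
move=> puv /iter_findex; set k := findex _ _ _ => ku.
have trans j : par u (iter (j * k) walk u) /\
    pos (iter (j * k) walk u) + j * pos u = pos u + j * pos v.
  elim: j => [|j [pj sj]]; first by rewrite mul0n par_refl.
  rewrite mulSn iterD; have := par_iter k pj; rewrite ku => pvj.
  by split; [exact: par_trans pvj|have := par_pos k pj; rewrite ku; lia].
have [_] := trans period; rewrite mulnC iter_period_mul.
have p0 := period_gt0 => eqp.
apply: vertex_inj; first exact: par_level.
by have : period * pos u = period * pos v; [lia|nia].
Qed.

(** Until the first disagreement the order of the positions is kept, and going up is a condition of
    small position; so at the disagreement the upper walk goes up and the lower one goes down. *)
Lemma not_par_split u v : level u = level v -> pos u < pos v -> ~~ par u v ->
  exists2 k, (forall j, j < k -> goes_up (iter j walk u) = goes_up (iter j walk v))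
    & goes_up (iter k walk u) && ~~ goes_up (iter k walk v).
Proof.
move=> luv ltuv npar.
have ex : exists k, goes_up (iter k walk u) != goes_up (iter k walk v).
  move: npar; rewrite negb_and luv eqxx /= => /forallPn[k nk]; by exists k.
have [k nk mink] := ex_minnP ex; exists k.
  by move=> j lt_jk; apply: contraTeq lt_jk => /mink; lia.
have [|lk pk] := @agree_iter u v k luv.
  by move=> j lt_jk; apply: contraTeq lt_jk => /mink; lia.
by move: nk; rewrite /goes_up lk; lia.
Qed.

(* The mirror image of [not_par_split]: the two walks come together. *)
Lemma not_par_join u v : level u = level v -> pos u < pos v -> ~~ par u v ->
  exists k, [/\ k < period,
    goes_up (iter k walk u) && ~~ goes_up (iter k walk v),
    level (iter k.+1 walk u) = level (iter k.+1 walk v)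
    & forall j, k < j < period -> goes_up (iter j walk u) = goes_up (iter j walk v)].
Proof.
move=> luv ltuv npar.
pose P k := (k < period) && (goes_up (iter k walk u) != goes_up (iter k walk v)).
have exP : exists k, P k.
  move: npar; rewrite negb_and luv eqxx /= => /forallPn[k nk].
  by exists k; rewrite /P ltn_ord.
have [k /andP[ltk nk] maxk] := ex_maxnP exP (fun k Pk => ltnW (proj1 (andP Pk))).
have same j : k < j < period -> goes_up (iter j walk u) = goes_up (iter j walk v).
  case/andP=> ltkj ltj; apply: contraTeq ltkj => nj.
  by have := maxk j; rewrite /P ltj nj => /(_ isT); lia.
(* Starting from the end of the period, where both walks are home, levels and order are carried
   backwards through the steps that agree. *)
have back j : j < period - k ->
    level (iter (period - j) walk u) = level (iter (period - j) walk v) /\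
    pos (iter (period - j) walk u) < pos (iter (period - j) walk v).
  elim: j => [|j IHj] lt_j; first by rewrite subn0 !iter_period.
  have [|l1 p1] := IHj; first lia.
  have e : period - j = (period - j.+1).+1 by lia.
  rewrite e !iterS in l1 p1; have [|l2 p2] := walk_back _ l1; first by apply: same; lia.
  by split=> //; lia.
have [|lk pk] := back (period - k.+1); first lia.
rewrite subKn // in lk pk; exists k; split=> //.
move: nk; rewrite !goes_up_walk; rewrite !iterS in lk pk; rewrite -lk; lia.
Qed.

(** The rank inside the parallel class, counted from the top. It is invariant under the walk and
    will select one of the roots in tau for [w]. *)
Definition idx w := #|[set q | par q w && (pos q < pos w)]|.

Definition class_size w := #|[set q | par q w]|.

Lemma idx_lt w : idx w < class_size w.
Proof.
apply/proper_card/properP; split.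
  by apply/subsetP=> q; rewrite !inE => /andP[].
by exists w; rewrite !inE ?par_refl // ltnn andbF.
Qed.

Lemma idx_inj u v : par u v -> idx u = idx v -> u = v.
Proof.
wlog: u v / pos u <= pos v => [hw puv|].
  by case: (leqP (pos u) (pos v)) => [/hw|/ltnW/hw le]; [exact|]
     => e; apply/esym/le; rewrite // par_sym.
rewrite leq_eqVlt => /predU1P[pe puv _|lt puv eqi].
  by apply: vertex_inj => //; exact: par_level.
suff: idx u < idx v by rewrite eqi ltnn.
apply/proper_card/properP; split.
  apply/subsetP=> q; rewrite !inE => /andP[/par_trans-> //]; lia.
by exists u; rewrite !inE ?puv // ltnn andbF.
Qed.

Lemma idx_walk w : idx (walk w) = idx w.
Proof.
rewrite /idx -[RHS](card_imset _ walk_inj); apply: eq_card => q; rewrite !inE.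
apply/idP/imsetP => [/andP[pq ltq]|[q' + ->]].
  have [q' eq'] : exists q', q = walk q'.
    by exists (finv walk q); rewrite f_finv //; exact: walk_inj.
  exists q' => //; rewrite inE; move: pq ltq; rewrite eq' par_walk => pq.
  by have := par_pos_walk pq; rewrite pq; lia.
rewrite inE par_walk => /andP[pq]; by rewrite pq; have := par_pos_walk pq; lia.
Qed.

Lemma class_size_par u v : par u v -> class_size u = class_size v.
Proof.
move=> puv; apply: eq_card => q; rewrite !inE.
by apply/idP/idP => /par_trans; apply; rewrite // par_sym.
Qed.

Lemma class_size_walk w : class_size (walk w) = class_size w.
Proof.
rewrite /class_size -[RHS](card_imset _ walk_inj); apply: eq_card => q; rewrite !inE.
apply/idP/imsetP => [pq|[q' + ->]]; last by rewrite inE par_walk.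
have [q' eq'] : exists q', q = walk q'.
  by exists (finv walk q); rewrite f_finv //; exact: walk_inj.
by exists q' => //; rewrite inE -par_walk -eq'.
Qed.

(** Taking the topmost parallel vertex makes the choice of a representative commute with [walk],
    because parallel walks keep their order. *)
Definition first w : vtx := [arg min_(q < w | par q w) pos q].

Lemma firstP w : par (first w) w /\ forall q, par q w -> pos (first w) <= pos q.
Proof. by rewrite /first; case: arg_minnP => [|q pq minq]; rewrite ?par_refl. Qed.

Lemma first_unique v w : par v w -> (forall q, par q w -> pos v <= pos q) -> first w = v.
Proof.
move=> pv minv; have [pf minf] := firstP w.
apply: vertex_inj; first by rewrite (par_level pf) (par_level pv).
by have := minv _ pf; have := minf _ pv; lia.
Qed.

Lemma first_par u v : par u v -> first u = first v.
Proof.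
move=> puv; have [pf minf] := firstP v; apply: first_unique.
  by apply: par_trans pf _; rewrite par_sym.
by move=> q pq; apply: minf; apply: par_trans puv.
Qed.

Lemma first_walk w : first (walk w) = walk (first w).
Proof.
have [pf minf] := firstP w; apply: first_unique; first by rewrite par_walk.
move=> q pq; have [q' eq'] : exists q', q = walk q'.
  by exists (finv walk q); rewrite f_finv //; exact: walk_inj.
move: pq; rewrite eq' par_walk => pq; have := minf _ pq.
by have := par_pos_walk pq; have := par_pos_walk pf; lia.
Qed.

(* The square size of the linear system defining the homomorphisms from the
   band of an orbit: the walk preserves [pos] going up and [copos] going
   down. *)
Lemma sum_orbit_dim (C : {set vtx}) : (forall w, (walk w \in C) = (w \in C)) ->
  \sum_(w in C) band_dim m (level w) =
  \sum_(w in C) band_dim m (if goes_up w then level (walk w) else level w).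
Proof.
move=> stabC.
have dimE w : band_dim m (if goes_up w then level (walk w) else level w)
    = pos w + copos (walk w) + 1.
  have := pos_copos w; have := pos_copos (walk w); rewrite /band_dim.
  by case: ifP => [/upper_walkP[]|/negbT/lower_walkP[]]; lia.
have dimE' w : band_dim m (level w) = pos w + copos w + 1.
  by rewrite pos_copos.
rewrite (eq_bigr _ (fun w _ => dimE w)) (eq_bigr _ (fun w _ => dimE' w)).
rewrite !big_split /=; congr (_ + _ + _); rewrite (reindex_inj walk_inj) /=.
by apply: eq_bigl.
Qed.

Lemma card_level i : i <= n -> #|[set q : vtx | level q == i]| = band_dim m i.
Proof.
move=> le_in.
pose h (j : 'I_(band_dim m i)) : vtx :=
  Tagged (fun k : 'I_n.+1 => 'I_(band_dim m k))
    (j : 'I_(band_dim m (Ordinal (le_in : i < n.+1)))).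
have h_inj : injective h.
  by move=> j j' /(congr1 (@pos n m)) /= /val_inj.
rewrite -[RHS]card_ord -(card_imset _ h_inj); apply: eq_card => q.
rewrite inE; apply/eqP/imsetP => [lq|[j _ ->] //].
have ltq : pos q < band_dim m i.
  by rewrite /band_dim -lq; have := pos_copos q; lia.
by exists (Ordinal ltq) => //; apply: vertex_inj.
Qed.

End Combinatorics.

Local Open Scope ring_scope.

(** * Counting distinct roots by a rank condition *)

Section DistinctRoots.

(* A linear system for the pairs [(g, b)] of polynomials of size at most [r]
   with ['X * g * F^`() + b * F = 0]: in characteristic 0, for [F != 0], it has
   a nonzero solution iff [F] has fewer than [r] distinct nonzero roots. *)
Definition distinct_roots_mx (R : nzRingType) (r s : nat) (F : {poly R}) :
    'M[R]_(r + r, s) :=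
  col_mx (\matrix_(i < r) poly_rV ('X * 'X^i * F^`()))
         (\matrix_(i < r) poly_rV ('X^i * F)).

Lemma map_distinct_roots_mx (R S : nzRingType) (phi : {rmorphism R -> S}) r s
    (F : {poly R}) :
  map_mx phi (distinct_roots_mx r s F) = distinct_roots_mx r s (map_poly phi F).
Proof.
rewrite map_col_mx; congr col_mx; apply/matrixP=> i j; rewrite !mxE.
  by rewrite deriv_map -(map_polyX phi) -rmorphXn -!rmorphM coef_map.
by rewrite -(map_polyXn phi) -!rmorphM coef_map.
Qed.

Lemma size_deriv_pred (R : nzRingType) (p : {poly R}) : (size p^`() <= (size p).-1)%N.
Proof.
have [->|p_neq0] := eqVneq p 0; first by rewrite deriv0 size_poly0.
by have := lt_size_deriv p_neq0; lia.
Qed.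

(** The bound on [s] prevents [poly_rV] from truncating the products. *)
Lemma mul_distinct_roots_mx (F : fieldType) (p : {poly F}) r s (g b : 'rV[F]_r) :
  (size p + r <= s)%N ->
  rVpoly (row_mx g b *m distinct_roots_mx r s p)
    = 'X * rVpoly g * p^`() + rVpoly b * p.
Proof.
move=> le_s; rewrite mul_row_col linearD /=.
have sumE (h : nat -> {poly F}) (c : 'rV[F]_r) : (forall i : 'I_r, size (h i) <= s)%N ->
    rVpoly (c *m (\matrix_(i < r) poly_rV (h i) : 'M_(r, s))) = \sum_(i < r) c 0 i *: h i.
  move=> size_h; rewrite mulmx_sum_row linear_sum /=.
  by apply: eq_bigr => i _; rewrite linearZ rowK /= poly_rV_K ?size_h.
have rVE (c : 'rV[F]_r) : rVpoly c = \sum_(i < r) c 0 i *: 'X^i.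
  rewrite /rVpoly poly_def; apply: eq_bigr => i _.
  by rewrite valK.
rewrite (sumE (fun i => 'X * 'X^i * p^`())) ?(sumE (fun i => 'X^i * p)).
- rewrite !rVE mulr_sumr !mulr_suml; congr (_ + _); apply: eq_bigr => i _.
    by rewrite -scalerAr -scalerAl.
  by rewrite -scalerAl.
- move=> i; apply: leq_trans (size_polyMleq _ _) _.
  by rewrite size_polyXn; have := ltn_ord i; lia.
move=> i; rewrite -exprS; apply: leq_trans (size_polyMleq _ _) _.
rewrite size_polyXn; have := ltn_ord i.
have : (size p^`() <= (size p).-1)%N := size_deriv_pred p.
move: le_s; move: (size p) (size p^`()) => x y; lia.
Qed.

(** Each term of the product rule misses one factor, and [h] vanishes at the root of that factor.
    Repetitions in [rs] are allowed. *)
Lemma prod_XsubC_dvdp_deriv (F : fieldType) (rs : seq F) (h : {poly F}) :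
  (forall z, z \in rs -> root h z) ->
  \prod_(z <- rs) ('X - z%:P) %| h * (\prod_(z <- rs) ('X - z%:P))^`().
Proof.
elim: rs => [|z rs IHrs] hz; first by rewrite big_nil dvd1p.
rewrite big_cons derivM derivXsubC mul1r mulrDr dvdp_add //.
  by rewrite dvdp_mul // dvdp_XsubCl hz ?mem_head.
rewrite mulrCA dvdp_mul2l ?polyXsubC_eq0 // IHrs // => y yrs.
by rewrite hz // in_cons yrs orbT.
Qed.

(** With fewer than [r] distinct nonzero roots, let g be the product of the X - z over them. Then p
    divides X g p', the factor X taking care of the root 0, and the opposite of the quotient
    completes g to a nonzero vector of the left kernel. *)
Lemma distinct_roots_of_row_free (L : closedFieldType) (p : {poly L}) r s :
  p != 0 -> (size p + r <= s)%N -> row_free (distinct_roots_mx r s p) ->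
  exists rs : seq L, [/\ uniq rs, size rs = r & {in rs, forall z, root p z && (z != 0)}].
Proof.
move=> p_neq0 le_s freeM.
have [zs pE] := closed_field_poly_normal p.
have lc_neq0 : lead_coef p != 0 by rewrite lead_coef_eq0.
pose rs := undup [seq z <- zs | z != 0].
have rsP z : z \in rs = root p z && (z != 0).
  by rewrite mem_undup mem_filter andbC pE rootZ // root_prod_XsubC.
have uniq_rs : uniq rs by exact: undup_uniq.
have [le_r|lt_r] := leqP r (size rs).
  exists (take r rs); split; first exact: take_uniq.
    by rewrite size_takel.
  by move=> z /mem_take; rewrite rsP.
pose g := \prod_(z <- rs) ('X - z%:P).
have /dvdpP[b bE] : p %| 'X * g * p^`().
  rewrite pE derivZ -scalerAr dvdpZl // dvdpZr // prod_XsubC_dvdp_deriv // => z zzs.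
  rewrite rootM rootX; case: eqVneq => //= z_neq0.
  by rewrite root_prod_XsubC rsP z_neq0 pE rootZ // root_prod_XsubC zzs.
have g_neq0 : g != 0 by rewrite monic_neq0 ?monic_prod_XsubC.
have size_g : (size g <= r)%N by rewrite size_prod_XsubC.
have size_b : (size b <= r)%N.
  have [->|b_neq0] := eqVneq b 0; first by rewrite size_poly0.
  have p_gt0 : (0 < size p)%N by rewrite lt0n size_poly_eq0.
  have := size_mul b_neq0 p_neq0; rewrite -bE.
  have := size_polyMleq ('X * g) p^`(); rewrite ['X * g]mulrC size_mulX //.
  have : (size p^`() <= (size p).-1)%N := size_deriv_pred p.
  have : (size g <= r)%N := size_g.
  move: (size p) (size p^`()) (size g) (size b) p_gt0 => x y z t ? ? ? + eqs.
  by rewrite eqs; lia.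
have /row_free_inj inj := freeM.
have : row_mx (poly_rV g) (poly_rV (- b)) = 0 :> 'rV[L]_(r + r).
  apply/inj; rewrite mul0mx; apply: (can_inj (@rVpolyK _ _)).
  by rewrite mul_distinct_roots_mx // !poly_rV_K ?size_polyN // bE mulNr subrr linear0.
rewrite -row_mx0 => /eq_row_mx[/(congr1 rVpoly)].
by rewrite poly_rV_K // linear0 => /eqP; rewrite (negPf g_neq0).
Qed.

(** At a root z of multiplicity k+1, write p = q (X - z)^(k+1). Dividing the relation by (X - z)^k
    and evaluating at z leaves (k+1) z g(z) q(z) = 0. In characteristic 0 this gives g(z) = 0, so g
    has too many roots for its size. *)
Lemma row_free_distinct_roots (F : fieldType) (p : {poly F}) (rs : seq F) s :
  [pchar F] =i pred0 -> p != 0 -> (size p + size rs <= s)%N ->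
  uniq rs -> {in rs, forall z, root p z && (z != 0)} ->
  row_free (distinct_roots_mx (size rs) s p).
Proof.
move=> charF p_neq0 le_s uniq_rs rsP.
apply: inj_row_free => v.
rewrite -[v]hsubmxK; set g := lsubmx v; set b := rsubmx v => vM.
have := congr1 rVpoly vM; rewrite mul_distinct_roots_mx // linear0 => eq0.
have g0 : rVpoly g = 0.
  apply/eqP; apply: contraLR (leqnn (size rs)) => g_neq0; rewrite -ltnNge.
  apply: leq_trans (_ : size (rVpoly g) <= _)%N; last exact: size_poly.
  apply: max_poly_roots => //; apply/allP=> z zrs.
  have /andP[pz z_neq0] := rsP z zrs.
  have [k [q + pE]] := multiplicity_XsubC p z; rewrite p_neq0 /= => qz.
  case: k pE => [|k] pE; first by rewrite pE mulr1 (negPf qz) in pz.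
  have : ('X - z%:P) ^+ k * ('X * rVpoly g * (q^`() * ('X - z%:P) + q *+ k.+1)
      + rVpoly b * q * ('X - z%:P)) = 0.
    rewrite -[RHS]eq0 pE derivM deriv_exp derivXsubC exprS /=.
    by rewrite -[q *+ _]mulr_natr -[_ *+ k.+1]mulr_natr; ring.
  move/eqP; rewrite mulf_eq0 expf_eq0 polyXsubC_eq0 andbF /= => /eqP/(congr1 (horner^~ z)).
  rewrite !hornerE hornerMn subrr !mulr0 addr0 add0r => /eqP.
  rewrite !mulf_eq0 (negPf z_neq0) /= -mulr_natr mulf_eq0 [_.[z] == 0 in X in _ || X](negPf qz).
  by rewrite ((pcharf0P _).1 charF) orbF.
have b0 : rVpoly b = 0.
  move/eqP: eq0; rewrite g0 mulr0 mul0r add0r mulf_eq0 (negPf p_neq0) orbF.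
  by move/eqP.
by rewrite -[g]rVpolyK -[b]rVpolyK g0 b0 linear0 row_mx0.
Qed.

(** The witness is a maximal minor of [M] that does not vanish under [phi0]; a rank condition thus
    becomes the nonvanishing of one element of [R]. *)
Lemma row_free_minor (R : comNzRingType) (L : fieldType) (phi0 : {rmorphism R -> L})
    k s (M : 'M[R]_(k, s)) :
  row_free (map_mx phi0 M) ->
  exists2 d : R, phi0 d != 0 &
    forall phi : {rmorphism R -> L}, phi d != 0 -> row_free (map_mx phi M).
Proof.
move=> freeM; have fullM : row_full (map_mx phi0 M)^T.
  by rewrite /row_full mxrank_tr.
pose f := fullrankfun fullM.
exists (\det (colsub f M)).
  rewrite -det_map_mx -unitfE -unitmxE -unitmx_tr.
  have -> : (map_mx phi0 (colsub f M))^T = rowsub f (map_mx phi0 M)^T.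
    by apply/matrixP=> i j; rewrite !mxE.
  exact: fullrowsub_unit.
move=> phi; rewrite -det_map_mx => dM.
have uM : map_mx phi (colsub f M) \in unitmx by rewrite unitmxE unitfE.
apply: inj_row_free => v vM; apply: (can_inj (mulmxK uM)); rewrite mul0mx.
apply/rowP=> j; have /rowP/(_ (f j)) := vM; rewrite !mxE => e0.
by rewrite -[RHS]e0; apply: eq_bigr => i _; rewrite !mxE.
Qed.

End DistinctRoots.

(** * Extension by zero of vectors indexed by a subset *)

Section ExtendRow.
Variables (R : pzRingType) (T : finType) (A : {pred T}) (N : nat).
Hypothesis eN : N = #|A|.

Definition row_index (j : 'I_N) : T := enum_val (cast_ord eN j).

(** Written as a sum, the extension needs no proof that [t] lies in [A]. *)
Definition ext_row (v : 'rV[R]_N) (t : T) : R :=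
  \sum_j (if row_index j == t then v 0 j else 0).

Lemma row_index_inj : injective row_index.
Proof. by move=> i j /enum_val_inj/cast_ord_inj. Qed.

Lemma row_index_in j : row_index j \in A.
Proof. exact: enum_valP. Qed.

Lemma row_index_onto t : t \in A -> exists j, t = row_index j.
Proof.
move=> tA; exists (cast_ord (esym eN) (enum_rank_in tA t)).
by rewrite /row_index cast_ordKV enum_rankK_in.
Qed.

Lemma ext_row_index v j : ext_row v (row_index j) = v 0 j.
Proof.
rewrite /ext_row (bigD1 j) //= eqxx big1 ?addr0 // => i ne_ij.
by rewrite (inj_eq row_index_inj) (negPf ne_ij).
Qed.

Lemma ext_row_out v t : t \notin A -> ext_row v t = 0.
Proof.
move=> tA; apply: big1 => j _; case: eqP => // e.
by rewrite -e row_index_in in tA.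
Qed.

Lemma sum_ext_row (v : 'rV[R]_N) (h : T -> R) :
  \sum_j v 0 j * h (row_index j) = \sum_t ext_row v t * h t.
Proof.
under [RHS]eq_bigr do rewrite mulr_suml.
rewrite exchange_big /=; apply: eq_bigr => j _.
rewrite (bigD1 (row_index j)) //= eqxx big1 ?addr0 // => t ne_t.
by rewrite eq_sym (negPf ne_t) mul0r.
Qed.

Lemma ext_rowK (g : T -> R) : (forall t, t \notin A -> g t = 0) ->
  ext_row (\row_j g (row_index j)) =1 g.
Proof.
move=> gA t; case: (boolP (t \in A)) => tA; last by rewrite ext_row_out ?gA.
by have [j ->] := row_index_onto tA; rewrite ext_row_index mxE.
Qed.

End ExtendRow.

(** * The linear system for homomorphisms from band modules *)

Section BandSystem.
Variables (n : nat) (m : nat -> nat).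
Hypotheses (m_0 : m 0%N = 0%N) (m_n1 : m n.+1 = 0%N).
Local Notation vtx := (vertex n m).
Implicit Types w q p : vtx.

Definition target_level w := if goes_up w then level (walk w) else level w.

(** The equations at [w] compare two expressions of the value there: one from the unknown of [w],
    the other from the unknown of its predecessor in the walk. *)
Definition eq_index p : {pred vtx * vtx} :=
  [pred a | fconnect (@walk n m) p a.1 && (level a.2 == level a.1)].

Definition unknown_index p : {pred vtx * vtx} :=
  [pred a | fconnect (@walk n m) p a.1 && (level a.2 == target_level a.1)].

Lemma fconnect_walkr p w : fconnect (@walk n m) p (walk w) = fconnect (@walk n m) p w.
Proof.
by apply/esym/(same_connect_r (fconnect_sym (walk_inj m_0 m_n1))); exact: fconnect1.
Qed.

Lemma card_band_index p : #|eq_index p| = #|unknown_index p|.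
Proof.
have cardE (l : vtx -> nat) : (forall w, l w <= n)%N ->
    #|[pred a : vtx * vtx | fconnect (@walk n m) p a.1 && (level a.2 == l a.1)]|
    = (\sum_(w in [set w | fconnect (@walk n m) p w]) band_dim m (l w))%N.
  move=> le_l; rewrite -sum1_card /=.
  rewrite -(pair_big_dep _ (fun w q => level q == l w) (fun _ _ => 1%N)) /=.
  apply: eq_big => [w|w _]; first by rewrite inE.
  rewrite -(card_level m_0 m_n1 (le_l w)) -sum1_card.
  by apply: eq_bigl => q; rewrite inE.
rewrite !cardE; first apply: sum_orbit_dim => //.
- by move=> w; rewrite !inE fconnect_walkr.
- by move=> w; rewrite /target_level; case: ifP => _; exact: level_le.
- by move=> w; exact: level_le.
Qed.

Section System.
Variables (R : comNzRingType) (u d : vtx -> vtx -> R) (tau : R) (p : vtx).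

(* The unknown attached to [w] is the value at the target of the arrow that
   gives the relation between the values at [w] and at [walk w]; [alpha] and
   [gamma] recover these two values from it. *)
Definition alpha w q q' := if goes_up w then u q q' else (q == q')%:R.
Definition gamma w q q' := if goes_up w then (q == q')%:R else d q q'.

Definition twist w : R := if w == p then tau else 1.

Definition band_entry (a b : vtx * vtx) : R :=
  (if walk b.1 == a.1 then gamma b.1 a.2 b.2 else 0)
  - (if b.1 == a.1 then twist a.1 * alpha b.1 a.2 b.2 else 0).

(** [card_band_index] reindexes the unknowns by the number of equations, which makes the matrix
    square. *)
Definition band_mx : 'M[R]_(#|eq_index p|) :=
  \matrix_(i, j) band_entry (enum_val i) (row_index (card_band_index p) j).

Definition band_det : R := \det band_mx.

End System.

Lemma map_band_det (R S : comNzRingType) (phi : {rmorphism R -> S})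
    (u d : vtx -> vtx -> R) tau p :
  phi (band_det u d tau p) =
  band_det (fun q q' => phi (u q q')) (fun q q' => phi (d q q')) (phi tau) p.
Proof.
rewrite /band_det -det_map_mx; congr (\det _); apply/matrixP=> i j; rewrite !mxE.
rewrite /band_entry /alpha /gamma /twist rmorphB.
congr (_ - _); case: ifP => _; rewrite ?rmorph0 //.
  by case: ifP; rewrite ?rmorph_nat.
by rewrite rmorphM; congr (_ * _); case: ifP; rewrite ?rmorph1 ?rmorph_nat.
Qed.

Section Families.
Variables (F : fieldType) (u d : vtx -> vtx -> F).
Local Notation V := {ffun vtx -> F^o}.
Implicit Types f g : V.

Definition appl (c : vtx -> vtx -> F) f : V := [ffun q => \sum_q' c q q' * f q'].

Lemma appl0 c : appl c 0 = 0.
Proof. by apply/ffunP=> q; rewrite !ffunE big1 // => q' _; rewrite ffunE mulr0. Qed.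

Lemma applD c f g : appl c (f + g) = appl c f + appl c g.
Proof.
apply/ffunP=> q; rewrite !ffunE -big_split /=.
by apply: eq_bigr => q' _; rewrite ffunE mulrDr.
Qed.

Lemma applZ c a f : appl c (a *: f) = a *: appl c f.
Proof.
apply/ffunP=> q; rewrite !ffunE scaler_sumr.
by apply: eq_bigr => q' _; rewrite ffunE; rewrite mulrCA.
Qed.

(** Vectors of all the spaces F_i live in one space of functions on the vertices, and the level is
    recorded by the support; this avoids dependent types. *)
Definition supp (i : nat) f := forall q, level q != i -> f q = 0.

Lemma supp0 i : supp i 0. Proof. by move=> q _; rewrite ffunE. Qed.

Lemma suppD i f g : supp i f -> supp i g -> supp i (f + g).
Proof. by move=> sf sg q lq; rewrite ffunE sf ?sg ?addr0. Qed.

Lemma suppZ i a f : supp i f -> supp i (a *: f).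
Proof. by move=> sf q lq; rewrite ffunE sf ?scaler0. Qed.

(** A relation rather than a map, since in the upper case [f'] is only a preimage of [f] under
    [u]. *)
Definition step w f f' :=
  [/\ supp (level w) f, supp (level (walk w)) f'
    & if goes_up w then f = appl u f' else f' = appl d f].

Lemma step0 w : step w 0 0.
Proof. by split; [exact: supp0..|rewrite !appl0; case: ifP]. Qed.

Lemma stepD w f f' g g' : step w f f' -> step w g g' -> step w (f + g) (f' + g').
Proof.
move=> [sf sf' ef] [sg sg' eg]; split; [exact: suppD..|].
by rewrite !applD; case: ifP ef eg => _ -> ->.
Qed.

Lemma stepZ w a f f' : step w f f' -> step w (a *: f) (a *: f').
Proof.
move=> [sf sf' ef]; split; [exact: suppZ..|].
by rewrite !applZ; case: ifP ef => _ ->.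
Qed.

Lemma step_sum (I : Type) (r : seq I) (P : pred I) w (f f' : I -> V) :
  (forall i, P i -> step w (f i) (f' i)) ->
  step w (\sum_(i <- r | P i) f i) (\sum_(i <- r | P i) f' i).
Proof.
move=> sf; apply: (big_ind2 (step w)) => //; first exact: step0.
by move=> *; exact: stepD.
Qed.

(* Homomorphisms to the representation (u, d) from the band module of the
   orbit of [p] with scalar [tau] on the edge closing the orbit at [p]. *)
Definition band_hom (tau : F) p (z : vtx -> V) :=
  forall w, fconnect (@walk n m) p w -> step w (z w) (twist tau p (walk w) *: z (walk w)).

Hypothesis u_level : forall q q', level q' != (level q).+1 -> u q q' = 0.
Hypothesis d_level : forall q q', level q' != (level q).+1 -> d q q' = 0.

Lemma supp_appl (c : vtx -> vtx -> F) i f :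
  (forall q q', level q' != (level q).+1 -> c q q' = 0) ->
  supp i.+1 f -> supp i (appl c f).
Proof.
move=> c_level sf q lq; rewrite ffunE big1 // => q' _.
have [lq'|lq'] := eqVneq (level q') (level q).+1; last by rewrite c_level ?mul0r.
by rewrite sf ?mulr0 // lq' eqSS.
Qed.

Definition unknown p (v : 'rV[F]_(#|eq_index p|)) w : V :=
  [ffun q => ext_row (card_band_index p) v (w, q)].

Lemma mul_band_mx tau p (v : 'cV[F]_(#|eq_index p|)) i (a := enum_val i)
    (g := unknown v^T) :
  (band_mx u d tau p *m v) i 0 =
    appl (gamma d (finv (@walk n m) a.1)) (g (finv (@walk n m) a.1)) a.2
    - twist tau p a.1 * appl (alpha u a.1) (g a.1) a.2.
Proof.
have -> : (band_mx u d tau p *m v) i 0 =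
    \sum_j v^T 0 j * band_entry u d tau p a (row_index (card_band_index p) j).
  by rewrite mxE; apply: eq_bigr => j _; rewrite !mxE mulrC.
rewrite (sum_ext_row (card_band_index p) v^T (band_entry u d tau p a)).
rewrite (_ : \sum_t _ = \sum_w \sum_q
    ext_row (card_band_index p) v^T (w, q) * band_entry u d tau p a (w, q)); last first.
  by rewrite pair_bigA; apply: eq_bigr => -[].
under eq_bigr => w _ do
  under eq_bigr => q _ do rewrite /band_entry /= mulrBr.
under eq_bigr => w _ do rewrite sumrB.
rewrite sumrB; congr (_ - _).
  rewrite (bigD1 (finv (@walk n m) a.1)) //= [X in _ + X]big1 ?addr0.
    rewrite ffunE; apply: eq_bigr => q _; rewrite ffunE.
    by rewrite f_finv ?eqxx 1?mulrC //; exact: walk_inj.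
  move=> w ne_w; apply: big1 => q _; rewrite ifN ?mulr0 //.
  by apply: contra ne_w => /eqP<-; rewrite finv_f //; exact: walk_inj.
rewrite (bigD1 a.1) //= [X in _ + X]big1 ?addr0.
  rewrite ffunE mulr_sumr; apply: eq_bigr => q _.
  by rewrite eqxx ffunE mulrC mulrA.
by move=> w ne_w; apply: big1 => q _; rewrite (negPf ne_w) mulr0.
Qed.

Lemma appl_id (f : V) : appl (fun q q' => (q == q')%:R) f = f.
Proof.
apply/ffunP=> q; rewrite ffunE (bigD1 q) //= eqxx mul1r big1 ?addr0 // => q' ne.
by rewrite eq_sym (negPf ne) mul0r.
Qed.

Lemma appl_alpha w f : appl (alpha u w) f = if goes_up w then appl u f else f.
Proof. by rewrite /alpha; case: ifP => // _; exact: appl_id. Qed.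

Lemma appl_gamma w f : appl (gamma d w) f = if goes_up w then f else appl d f.
Proof. by rewrite /gamma; case: ifP => // _; exact: appl_id. Qed.

(** A vector of the kernel provides the unknowns; [alpha] turns them into the values [z w], and the
    equations of the system say that [gamma] yields the twisted value at the next vertex. *)
Lemma band_hom_exists tau p : band_det u d tau p = 0 ->
  exists2 z, band_hom tau p z & exists2 w, fconnect (@walk n m) p w & z w != 0.
Proof.
rewrite /band_det -det_tr => /eqP/det0P[v v_neq0].
move/(congr1 trmx); rewrite trmx_mul trmxK trmx0 => Jv.
pose g := unknown v.
have sg w : supp (target_level w) (g w).
  by move=> q lq; rewrite ffunE ext_row_out // !inE /= (negPf lq) andbF.
pose z w := appl (alpha u w) (g w).
have sz w : supp (level w) (z w).
  rewrite /z appl_alpha; have := sg w; rewrite /target_level; case: ifP => [up_w|_].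
    by have [-> _] := upper_walkP m_0 m_n1 up_w; exact: supp_appl.
  exact.
have sG w : supp (level (walk w)) (appl (gamma d w) (g w)).
  rewrite appl_gamma; have := sg w; rewrite /target_level; case: ifP => [_|/negbT up_w].
    exact.
  by have [-> _] := lower_walkP m_0 m_n1 up_w; exact: supp_appl.
have gz w : fconnect (@walk n m) p w ->
    appl (gamma d w) (g w) = twist tau p (walk w) *: z (walk w).
  move=> pw; apply/ffunP=> q.
  have [lq|lq] := eqVneq (level q) (level (walk w)); last first.
    by rewrite sG // (suppZ _ (sz _)).
  have aP : (walk w, q) \in eq_index p by rewrite inE /= fconnect_walkr pw lq eqxx.
  have /matrixP/(_ (enum_rank_in aP (walk w, q)) 0) := Jv.
  rewrite mul_band_mx enum_rankK_in //= !mxE finv_f; last exact: walk_inj.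
  by rewrite trmxK [X in _ -> _ = X]ffunE => /subr0_eq.
exists z.
  move=> w pw; split; [exact: sz|apply: suppZ; exact: sz|].
  rewrite -(gz w pw) /z appl_alpha appl_gamma.
  by case: (goes_up w); reflexivity.
apply/exists_inP; apply: contraR v_neq0; rewrite negb_exists_in => /forall_inP z0.
have {}z0 w : fconnect (@walk n m) p w -> z w = 0 by move/z0/negbNE/eqP.
apply/eqP/rowP=> j; rewrite mxE -(ext_row_index (card_band_index p)).
have := row_index_in (card_band_index p) j; case: (row_index _ j) => w q.
rewrite inE /= => /andP[pw _].
(* Each unknown is itself one of the two values that it determines, so it vanishes with them. *)
suff : g w = 0 by move/ffunP/(_ q); rewrite !ffunE.
have := z0 _ pw; have := gz _ pw.
rewrite z0 ?fconnect_walkr // scaler0 /z appl_alpha appl_gamma.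
by case: ifP.
Qed.

Lemma band_hom_eq0 tau p z : band_det u d tau p != 0 -> band_hom tau p z ->
  forall w, fconnect (@walk n m) p w -> z w = 0.
Proof.
move=> det_neq0 hz.
(* The unknowns are read off from the values of the homomorphism. *)
pose h w : V := if goes_up w then twist tau p (walk w) *: z (walk w) else z w.
pose g (a : vtx * vtx) : F := if fconnect (@walk n m) p a.1 then h a.1 a.2 else 0.
have gA a : a \notin unknown_index p -> g a = 0.
  rewrite !inE /g; case: ifP => //= pa la.
  have [sz sz' _] := hz _ pa; rewrite /h; rewrite /target_level in la.
  by case: ifP la => _ la; [exact: sz'|exact: sz].
pose v := \row_j g (row_index (card_band_index p) j).
have gE w : fconnect (@walk n m) p w ->
    unknown v w = h w.
  by move=> pw; apply/ffunP=> q; rewrite ffunE ext_rowK // /g /= pw.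
have hzE w : fconnect (@walk n m) p w -> appl (alpha u w) (h w) = z w.
  by move=> /hz[_ _ e]; rewrite appl_alpha /h; case: ifP e => // _ ->.
have hzE' w : fconnect (@walk n m) p w ->
    appl (gamma d w) (h w) = twist tau p (walk w) *: z (walk w).
  by move=> /hz[_ _ e]; rewrite appl_gamma /h; case: ifP e => // _ ->.
have Jv : band_mx u d tau p *m v^T = 0.
  apply/matrixP=> i j; rewrite ord1 mul_band_mx trmxK.
  have := enum_valP i; case: (enum_val i) => w q /= /andP[/= pw _].
  have pw' : fconnect (@walk n m) p (finv (@walk n m) w).
    by rewrite -fconnect_walkr f_finv //; exact: walk_inj.
  rewrite (gE _ pw) (gE _ pw') (hzE _ pw) (hzE' _ pw') f_finv; last exact: walk_inj.
  by rewrite ffunE mxE subrr.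
have v0 : v^T = 0.
  have uJ : band_mx u d tau p \in unitmx by rewrite unitmxE unitfE.
  by rewrite -(mulKmx uJ v^T) Jv mulmx0.
move=> w pw; rewrite -(hzE w pw) -(gE w pw).
have -> : v = 0 by rewrite -[v]trmxK v0 trmx0.
rewrite [X in appl _ X](_ : _ = 0) ?appl0 //.
by apply/ffunP=> q; rewrite !ffunE /ext_row big1 // => j _; rewrite mxE if_same.
Qed.

End Families.
End BandSystem.

(** * Representations as coefficient functions on pairs of vertices *)

Section Coefficients.
Variables (n : nat) (m : nat -> nat).
Hypotheses (m_0 : m 0%N = 0%N) (m_n1 : m n.+1 = 0%N).
Local Notation vtx := (vertex n m).
Implicit Types w q p : vtx.

Section Arrows.
Variable R : pzRingType.
Implicit Types A B : forall i : 'I_n, 'M[R]_(band_dim m i, band_dim m i.+1).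

(** At most one term of the sum passes the test. This encoding gives 0 away from consecutive levels
    and avoids casts between index types. *)
Definition arrow_coef A q q' : R :=
  \sum_(i < n) \sum_(r < band_dim m i) \sum_(s < band_dim m i.+1)
    if [&& level q == i, pos q == r, level q' == i.+1 & pos q' == s]
    then A i r s else 0.

Lemma arrow_coefE A (i : 'I_n) (r : 'I_(band_dim m i)) (s : 'I_(band_dim m i.+1)) :
  arrow_coef A (target_vertex r) (source_vertex s) = A i r s.
Proof.
rewrite /arrow_coef (bigD1 i) //= (bigD1 r) //= (bigD1 s) //=.
rewrite /level /pos /= !eqxx /= !big1 ?addr0 //.
- move=> j ne_j; apply: big1 => r' _; apply: big1 => s' _.
  by rewrite ifN // negb_and eq_sym; rewrite -val_eqE /= in ne_j; rewrite ne_j.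
- move=> r' ne_r; apply: big1 => s' _; rewrite ifN // negb_and eq_sym.
  by rewrite -val_eqE /= in ne_r; rewrite ne_r.
by move=> s' ne_s; rewrite ifN // eq_sym; rewrite -val_eqE /= in ne_s.
Qed.

Lemma arrow_coef_level A q q' : level q' != (level q).+1 -> arrow_coef A q q' = 0.
Proof.
move=> lq'; apply: big1 => i _; apply: big1 => r _; apply: big1 => s _.
rewrite ifN //; apply: contra lq' => /and4P[/eqP-> _ /eqP-> _]; exact: eqxx.
Qed.

Lemma target_vertexP q (i : 'I_n) : level q = i -> exists r, q = @target_vertex n m i r.
Proof.
move=> lq; have ltq : (pos q < band_dim m i)%N.
  by rewrite /band_dim -lq; have := pos_copos m_0 m_n1 q; lia.
by exists (Ordinal ltq); apply: vertex_inj.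
Qed.

Lemma source_vertexP q (i : 'I_n) : level q = i.+1 -> exists s, q = @source_vertex n m i s.
Proof.
move=> lq; have ltq : (pos q < band_dim m i.+1)%N.
  by rewrite /band_dim -lq; have := pos_copos m_0 m_n1 q; lia.
by exists (Ordinal ltq); apply: vertex_inj.
Qed.

Lemma sum_source (i : 'I_n) (h : vtx -> R) :
  (forall q, level q != i.+1 -> h q = 0) ->
  \sum_q h q = \sum_s h (@source_vertex n m i s).
Proof.
move=> h0; have inj : injective (@source_vertex n m i).
  by move=> s s' /(congr1 (@pos n m)) /= /val_inj.
pose S := [set @source_vertex n m i s | s in 'I_(band_dim m i.+1)].
rewrite -(big_imset _ (in2W inj)) /= [LHS](bigID (mem S)) /=.
rewrite [X in _ + X]big1 ?addr0 // => q nq; apply: h0.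
apply: contra nq => /eqP/source_vertexP[s ->]; exact: imset_f.
Qed.

Lemma appl_arrow_coef A (i : 'I_n) r (h : vtx -> R) :
  \sum_q arrow_coef A (target_vertex r) q * h q
    = \sum_s A i r s * h (source_vertex s).
Proof.
rewrite (@sum_source i).
  by apply: eq_bigr => s _; rewrite arrow_coefE.
by move=> q lq; rewrite arrow_coef_level ?mul0r.
Qed.

Lemma arrow_coef_comp A B :
  (forall i (h : (i.+1 < n)%N), A (Ordinal (ltnW h)) *m B (Ordinal h) = 0) ->
  forall q q'', \sum_q' arrow_coef A q q' * arrow_coef B q' q'' = 0.
Proof.
move=> AB0 q q''.
have [lq''|lq''] := eqVneq (level q'') (level q).+2; last first.
  apply: big1 => q' _.
  have [lq'|lq'] := eqVneq (level q') (level q).+1.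
    by rewrite (@arrow_coef_level B) ?mulr0 // lq'.
  by rewrite arrow_coef_level ?mul0r.
have lt : ((level q).+1 < n)%N by rewrite -lq''; exact: level_le.
have [r ->] := @target_vertexP q (Ordinal (ltnW lt)) erefl.
have [s ->] := @source_vertexP q'' (Ordinal lt) lq''.
rewrite appl_arrow_coef; have /matrixP/(_ r s) := AB0 _ lt; rewrite !mxE => e.
rewrite -[RHS]e; apply: eq_bigr => j _; congr (_ * _).
apply: etrans (@arrow_coefE B (Ordinal lt) j s); congr (arrow_coef B _ _).
Qed.

End Arrows.

Lemma rmorph_arrow_coef (R S : pzRingType) (phi : {rmorphism R -> S})
    (A : forall i : 'I_n, 'M[R]_(band_dim m i, band_dim m i.+1)) q q' :
  phi (arrow_coef A q q') = arrow_coef (fun i => map_mx phi (A i)) q q'.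
Proof.
rewrite rmorph_sum; apply: eq_bigr => i _; rewrite rmorph_sum; apply: eq_bigr => r _.
by rewrite rmorph_sum; apply: eq_bigr => s _; case: ifP; rewrite ?rmorph0 ?mxE.
Qed.

Lemma eq_arrow_coef (R : pzRingType)
    (A B : forall i : 'I_n, 'M[R]_(band_dim m i, band_dim m i.+1)) q q' :
  (forall i, A i = B i) -> arrow_coef A q q' = arrow_coef B q q'.
Proof.
move=> AB; apply: eq_bigr => i _; apply: eq_bigr => r _; apply: eq_bigr => s _.
by rewrite AB.
Qed.

Definition upper_arrow (R : Type) (x : quiver_rep R n (band_dim m)) (i : 'I_n) :=
  if odd (n - i.+1) then mapb x i else mapa x i.
Definition lower_arrow (R : Type) (x : quiver_rep R n (band_dim m)) (i : 'I_n) :=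
  if odd (n - i.+1) then mapa x i else mapb x i.

Definition upper_coef (R : pzRingType) (x : quiver_rep R n (band_dim m)) :=
  arrow_coef (upper_arrow x).
Definition lower_coef (R : pzRingType) (x : quiver_rep R n (band_dim m)) :=
  arrow_coef (lower_arrow x).

(** The parity of [n - i.+1] changes with [i], so two consecutive arrows of one color are an upper
    and a lower one: aa = bb = 0 reads ud = du = 0. *)
Lemma in_Rep_arrows (F : fieldType) (x : quiver_rep F n (band_dim m)) :
  in_Rep x <-> forall i (h : (i.+1 < n)%N),
    upper_arrow x (Ordinal (ltnW h)) *m lower_arrow x (Ordinal h) = 0 /\
    lower_arrow x (Ordinal (ltnW h)) *m upper_arrow x (Ordinal h) = 0.
Proof.
have oddE i : (i.+1 < n)%N -> odd (n - i.+1) = ~~ odd (n - i.+2).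
  by move=> h; have -> : (n - i.+1 = (n - i.+2).+1)%N by lia.
split=> relx i h; have := relx i h; rewrite /upper_arrow /lower_arrow /= oddE //.
  by case: (odd _) => /= -[].
by case: (odd _) => /= -[].
Qed.

Lemma upper_lower0 (F : fieldType) (x : quiver_rep F n (band_dim m)) : in_Rep x ->
  forall f, appl (upper_coef x) (appl (lower_coef x) f) = 0.
Proof.
move=> /in_Rep_arrows relx f; apply/ffunP=> q; rewrite !ffunE.
under eq_bigr do rewrite ffunE mulr_sumr.
rewrite exchange_big big1 //= => q'' _.
under eq_bigr do rewrite mulrA.
rewrite -mulr_suml arrow_coef_comp ?mul0r // => i h.
by have [] := relx i h.
Qed.

Lemma lower_upper0 (F : fieldType) (x : quiver_rep F n (band_dim m)) : in_Rep x ->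
  forall f, appl (lower_coef x) (appl (upper_coef x) f) = 0.
Proof.
move=> /in_Rep_arrows relx f; apply/ffunP=> q; rewrite !ffunE.
under eq_bigr do rewrite ffunE mulr_sumr.
rewrite exchange_big big1 //= => q'' _.
under eq_bigr do rewrite mulrA.
rewrite -mulr_suml arrow_coef_comp ?mul0r // => i h.
by have [] := relx i h.
Qed.

End Coefficients.

(** * Evaluation of the generic representation *)

Section Generic.
Variables (K L : fieldType) (iota : {rmorphism K -> L}) (n : nat) (m : nat -> nat).
Hypotheses (m_0 : m 0%N = 0%N) (m_n1 : m n.+1 = 0%N).
Local Notation vtx := (vertex n m).
Local Notation P := {mpoly K[#|Defs.coord n (band_dim m)|]}.
Local Notation rep := (quiver_rep L n (band_dim m)).

Definition eval_at (x : rep) : {rmorphism P -> L} :=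
  (meval (fun k => coord_val x (enum_val k)) \o map_mpoly iota).

Lemma eval_atE x p : eval_at x p = poly_eval iota p x.
Proof. by []. Qed.

Definition generic_rep : quiver_rep P n (band_dim m) :=
  let var b (i : 'I_n) : 'M[P]_(band_dim m i, band_dim m i.+1) :=
    \matrix_(r, s) 'X_(enum_rank
      ((b, Tagged (fun i : 'I_n => ('I_(band_dim m i) * 'I_(band_dim m i.+1))%type) (r, s))
        : Defs.coord n (band_dim m))) in
  QuiverRep (var true) (var false).

Lemma eval_generic_a x i : map_mx (eval_at x) (mapa generic_rep i) = mapa x i.
Proof.
apply/matrixP=> r s; rewrite !mxE /eval_at /= map_mpolyX mevalXU enum_rankK.
by [].
Qed.

Lemma eval_generic_b x i : map_mx (eval_at x) (mapb generic_rep i) = mapb x i.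
Proof.
by apply/matrixP=> r s; rewrite !mxE /eval_at /= map_mpolyX mevalXU enum_rankK.
Qed.

Lemma eval_upper_coef x q q' : eval_at x (upper_coef generic_rep q q') = upper_coef x q q'.
Proof.
rewrite rmorph_arrow_coef; apply: eq_arrow_coef => i; rewrite /upper_arrow.
by case: ifP => _; [exact: eval_generic_b|exact: eval_generic_a].
Qed.

Lemma eval_lower_coef x q q' : eval_at x (lower_coef generic_rep q q') = lower_coef x q q'.
Proof.
rewrite rmorph_arrow_coef; apply: eq_arrow_coef => i; rewrite /lower_arrow.
by case: ifP => _; [exact: eval_generic_a|exact: eval_generic_b].
Qed.

(** The determinant det J_p(x, tau), with tau as the polynomial variable. *)
Definition band_poly (R : comNzRingType) (x : quiver_rep R n (band_dim m)) (p : vtx) :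
    {poly R} :=
  band_det m_0 m_n1 (fun q q' => (upper_coef x q q')%:P)
    (fun q q' => (lower_coef x q q')%:P) 'X p.

Lemma eq_band_det (R : comNzRingType) (u u' d d' : vtx -> vtx -> R) tau p :
  u =2 u' -> d =2 d' -> band_det m_0 m_n1 u d tau p = band_det m_0 m_n1 u' d' tau p.
Proof.
move=> eq_u eq_d; congr (\det _); apply/matrixP=> i j; rewrite !mxE.
by rewrite /band_entry /alpha /gamma eq_u eq_d.
Qed.

Lemma map_band_poly x p : map_poly (eval_at x) (band_poly generic_rep p) = band_poly x p.
Proof.
rewrite /band_poly map_band_det /= map_polyX; apply: eq_band_det => q q'.
  by rewrite [LHS]map_polyC; congr (_%:P); exact: eval_upper_coef.
by rewrite [LHS]map_polyC; congr (_%:P); exact: eval_lower_coef.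
Qed.

Lemma horner_band_poly (x : rep) p tau :
  (band_poly x p).[tau] = band_det m_0 m_n1 (upper_coef x) (lower_coef x) tau p.
Proof.
rewrite -[LHS]/(horner_eval tau _) map_band_det /= /horner_eval hornerX.
by apply: eq_band_det => q q'; rewrite hornerC.
Qed.

End Generic.

(** * Polynomials and linear dependence in characteristic 0 *)

Section FieldFacts.
Variable F : fieldType.

Hypothesis charF : [pchar F] =i pred0.

Lemma natr_inj : injective (fun k : nat => k%:R : F).
Proof.
suff H k l : (k <= l)%N -> k%:R = l%:R :> F -> k = l.
  by move=> k l e; case/orP: (leq_total k l) => le; [exact: H|apply/esym/H].
move=> le e; have := (pcharf0P _).1 charF (l - k)%N.
by rewrite natrB // e subrr eqxx => /esym; rewrite subn_eq0; lia.
Qed.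

Lemma poly_vanish0 (g : {poly F}) : (forall x, g.[x] = 0) -> g = 0.
Proof.
move=> g0; apply: contraTeq (leqnn (size g)) => g_neq0; rewrite -ltnNge.
have := @max_poly_roots _ g [seq k%:R | k <- iota 0 (size g)] g_neq0.
rewrite size_map size_iota; apply.
  by apply/allP=> x _; apply/rootP.
by rewrite map_inj_uniq ?iota_uniq //; exact: natr_inj.
Qed.

(** A Vandermonde argument: by linearity the relations hold with g(t w) in place of the powers for
    every polynomial g, and the product of the X - t w' over w' != w isolates the term of w. *)
Lemma sum_pow_eq0 (V : lmodType F) (I : finType) (A : pred I) (t : I -> F) (y : I -> V) :
  {in A &, injective t} -> (forall j : nat, \sum_(w | A w) t w ^+ j *: y w = 0) ->
  forall w, A w -> y w = 0.
Proof.
move=> t_inj sum0 w Aw.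
have sumg (g : {poly F}) : \sum_(w' | A w') g.[t w'] *: y w' = 0.
  under eq_bigr do rewrite horner_coef scaler_suml.
  rewrite exchange_big big1 //= => j _.
  under eq_bigr do rewrite -scalerA.
  by rewrite -scaler_sumr sum0 scaler0.
have := sumg (\prod_(w' | A w' && (w' != w)) ('X - (t w')%:P)).
rewrite (bigD1 w) //= [X in _ + X]big1 ?addr0; last first.
  move=> w' /andP[Aw' ne]; rewrite (bigD1 w') ?Aw' //=.
  by rewrite !hornerE subrr mul0r scale0r.
move/eqP; rewrite scaler_eq0 => /orP[|/eqP //].
rewrite horner_prod prodf_seq_eq0 => /hasP[w' _ /andP[/andP[Aw' ne]]].
rewrite !hornerE subr_eq0 => /eqP/t_inj e.
by rewrite e ?eqxx // in ne.
Qed.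

Lemma ffun_dependent (T : finType) (v : 'I_#|T|.+1 -> {ffun T -> F^o}) :
  exists2 c : 'I_#|T|.+1 -> F, exists j, c j != 0 & \sum_j c j *: v j = 0.
Proof.
pose M : 'M[F]_(#|T|.+1, #|T|) := \matrix_(j, q) v j (enum_val q).
have : kermx M != 0.
  rewrite -mxrank_eq0 mxrank_ker; have := rank_leq_col M; lia.
case/rowV0Pn=> c /sub_kermxP cM c_neq0; exists (c 0).
  by have /rV0Pn := c_neq0.
apply/ffunP=> q; rewrite sum_ffunE ffunE.
have /rowP/(_ (enum_rank q)) := cM; rewrite !mxE => e; rewrite -[RHS]e.
by apply: eq_bigr => j _; rewrite !mxE ffunE enum_rankK.
Qed.

End FieldFacts.

(** * Chains that start or end at zero *)

Section Chains.
Variables (n : nat) (m : nat -> nat).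
Hypotheses (m_0 : m 0%N = 0%N) (m_n1 : m n.+1 = 0%N).
Local Notation vtx := (vertex n m).
Local Notation walk := (@walk n m).
Local Notation period := (period m_0 m_n1).
Implicit Types w q p : vtx.
Variables (F : fieldType) (u d : vtx -> vtx -> F).
Hypothesis charF : [pchar F] =i pred0.
Local Notation V := {ffun vtx -> F^o}.
Local Notation step := (step u d).
Hypothesis u_level : forall q q', level q' != (level q).+1 -> u q q' = 0.
Hypothesis d_level : forall q q', level q' != (level q).+1 -> d q q' = 0.
Hypothesis du0 : forall f : V, appl d (appl u f) = 0.
Hypothesis regular : forall p, exists2 D : {poly F}, D != 0 &
  forall tau, D.[tau] != 0 -> band_det m_0 m_n1 u d tau p != 0.

Definition chain p (v : nat -> V) := forall k, step (iter k walk p) (v k) (v k.+1).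

Lemma iter_add_period k j p : iter (k + j * period) walk p = iter k walk p.
Proof. by rewrite iterD iter_period_mul. Qed.

(* Summing a finite chain over the turns around the orbit, with weights the
   powers of [tau], gives a homomorphism from the band of scalar [tau]. *)
Lemma finite_chain_eq0 p (v : nat -> V) K : chain p v -> v 0%N = 0 ->
  (forall k, (K <= k)%N -> v k = 0) -> forall k, v k = 0.
Proof.
move=> chv v0 vK; set l := fingraph.order walk p.
have inj := walk_inj m_0 m_n1.
have l_gt0 : (0 < l)%N by exact: fingraph.order_gt0.
have iter_l k j : iter (k + j * l) walk p = iter k walk p.
  rewrite iterD; congr iter; elim: j => // j IHj.
  by rewrite mulSn iterD IHj; exact: iter_order.
pose f tau k := \sum_(j < K.+1) tau ^+ (K.+1 - j) *: v (k + j * l)%N.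
have stepf tau k : step (iter k walk p) (f tau k) (f tau k.+1).
  apply: step_sum => j _; apply: stepZ.
  by have := chv (k + j * l)%N; rewrite iter_l addSn.
(* One turn shifts the sum by one term: the last term vanishes because it lies beyond [K], and the
   first one because [v 0 = 0]. The decreasing exponents then produce the factor tau. *)
have fl tau : f tau l = tau *: f tau 0%N.
  rewrite /f big_ord_recr /= vK ?scaler0 ?addr0; last by nia.
  rewrite big_ord_recl /= v0 scaler0 add0r scaler_sumr; apply: eq_bigr => j _.
  rewrite scalerA -exprS /bump /= add1n mulSn subSS.
  by congr (_ ^+ _ *: _); have := ltn_ord j; lia.
have hom tau : band_hom u d tau p (fun w => f tau (findex walk p w)).
  move=> w pw; set k := findex walk p w.
  have wE : iter k walk p = w by exact: iter_findex.
  have lt_k : (k < l)%N by exact: findex_max.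
  have := stepf tau k; rewrite wE /twist; case: eqP => [wp|wp].
    have ek : k.+1 = l.
      apply/eqP; rewrite eqn_leq lt_k leqNgt; apply/negP => /findex_iter.
      by rewrite iterS wE wp findex0.
    by rewrite wp findex0 ek fl.
  have lt_k1 : (k.+1 < l)%N.
    rewrite ltn_neqAle lt_k andbT; apply/eqP => e; apply: wp.
    by rewrite -wE -iterS e; exact: iter_order.
  by rewrite -[X in findex walk p X](_ : iter k.+1 walk p = _) ?findex_iter ?scale1r // iterS wE.
have [D D_neq0 detD] := regular p.
have f0 tau k : D.[tau] != 0 -> (k < l)%N -> f tau k = 0.
  move=> Dt lt_k.
  have := @band_hom_eq0 _ _ m_0 m_n1 _ u d tau p _ (detD _ Dt) (hom tau) (iter k walk p).
  by rewrite fconnect_iter findex_iter //; apply.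
(* For fixed [k] and [q] the sum over the turns is a polynomial in tau which vanishes wherever [D]
   does not. It is therefore the zero polynomial, and its coefficients are entries of the chain. *)
have gk0 k q : (k < l)%N ->
    \sum_(j < K.+1) (v (k + j * l)%N q : F) *: 'X^(K.+1 - j) = 0 :> {poly F}.
  move=> lt_k; apply/eqP; have : D * \sum_(j < K.+1) (v (k + j * l)%N q : F) *: 'X^(K.+1 - j) = 0.
    apply: poly_vanish0 => // x; rewrite hornerM.
    have [->|Dx] := eqVneq D.[x] 0; first by rewrite mul0r.
    have /ffunP/(_ q) := f0 _ _ Dx lt_k; rewrite /f sum_ffunE ffunE => e.
    rewrite horner_sum [X in _ * X](_ : _ = 0) ?mulr0 // -[RHS]e.
    by apply: eq_bigr => j _; rewrite !hornerE ffunE [RHS]mulrC.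
  by move/eqP; rewrite mulf_eq0 (negPf D_neq0).
move=> k; rewrite (divn_eq k l) addnC; set j := (k %/ l)%N; set k' := (k %% l)%N.
have lt_k' : (k' < l)%N by rewrite ltn_mod.
have [le_j|lt_j] := leqP K.+1 j; first by apply: vK; nia.
apply/ffunP=> q; rewrite ffunE.
have /polyP/(_ (K.+1 - j)%N) := gk0 _ q lt_k'.
rewrite coef_sum (bigD1 (Ordinal lt_j)) //= coefZ coefXn eqxx mulr1 coef0.
rewrite big1 ?addr0 // => i ne; rewrite coefZ coefXn.
case: eqP => [e|]; rewrite ?mulr0 //; case/eqP: ne; apply: val_inj => /=.
by have := ltn_ord i; lia.
Qed.

Local Notation N := #|vtx|.

Lemma chain_shift p (v : nat -> V) j : chain p v -> chain p (fun k => v (k + j * period)%N).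
Proof. by move=> chv k; have := chv (k + j * period)%N; rewrite iter_add_period addSn. Qed.

Lemma chain_sum p (I : finType) (A : pred I) (c : I -> F) (v : I -> nat -> V) :
  (forall i, A i -> c i != 0 -> chain p (v i)) ->
  chain p (fun k => \sum_(i | A i) c i *: v i k).
Proof.
move=> chv k; apply: step_sum => i Ai.
have [->|ci] := eqVneq (c i) 0; first by rewrite !scale0r; exact: step0.
by apply: stepZ; exact: chv.
Qed.

Lemma min_nonzero M (c : 'I_M -> F) : (exists j, c j != 0) ->
  exists2 j, c j != 0 & forall i : 'I_M, (i < j)%N -> c i = 0.
Proof.
move=> [j0 cj0]; pose j := [arg min_(i < j0 | c i != 0) (i : nat)].
have := @arg_minnP _ j0 (fun i => c i != 0) (fun i => i : nat) cj0.
case=> i ci mini; exists i => // i' lt; apply/eqP; apply: contraTT lt => /mini.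
by rewrite leqNgt.
Qed.

(** A linear dependence among the N+1 vectors [v (j * period)] gives a combination of shifted chains
    that starts at 0 and ends, hence is 0. Isolating the least shift with nonzero coefficient
    expresses [v k] by later vectors, so vanishing propagates backwards from [K]. *)
Lemma ending_chain_eq0 p (v : nat -> V) K : chain p v ->
  (forall k, (K <= k)%N -> v k = 0) -> forall k, (N * period <= k)%N -> v k = 0.
Proof.
move=> chv vK.
have [c c_neq0 sum0] := ffun_dependent (fun j : 'I_N.+1 => v (j * period)%N).
pose w k := \sum_j c j *: v (k + j * period)%N.
have chw : chain p w.
  by apply: (chain_sum (A := predT)) => j _ _; exact: chain_shift.
have w0 : forall k, w k = 0.
  apply: (finite_chain_eq0 chw (K := K)) => // k le_k; apply: big1 => j _.
  by rewrite vK ?scaler0 //; lia.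
have P_gt0 := period_gt0 m_0 m_n1.
have [j cj minj] := min_nonzero c_neq0.
suff H i k : (K <= k + i)%N -> (j * period <= k)%N -> v k = 0.
  by move=> k le_k; apply: (H K); [lia|have := ltn_ord j; nia].
elim: i k => [|i IHi] k leK le_k; first by apply: vK; lia.
have := w0 (k - j * period)%N; rewrite /w (bigD1 j isT) subnK // big1.
  by rewrite /= addr0 => /eqP; rewrite scaler_eq0 (negPf cj) => /eqP.
move=> j' /andP[_ ne]; have [lt|le] := ltnP j' j; first by rewrite minj ?scale0r.
have lt_jj' : (j < j')%N by rewrite ltn_neqAle le andbT eq_sym val_eqE.
have le_P : (period + j * period <= j' * period)%N.
  by rewrite -mulSn leq_mul2r lt_jj' orbT.
by rewrite IHi ?scaler0 //; lia.
Qed.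

(** Copies of the chain, delayed by [j] periods and padded with zeros, are combined so that the sum
    vanishes at [Q * period], where it can be cut off. The finite chain so obtained is 0, and
    isolating the least delay makes vanishing propagate forwards. *)
Lemma starting_chain_eq0 p (v : nat -> V) : chain p v -> v 0%N = 0 -> forall k, v k = 0.
Proof.
move=> chv v0 k0.
have P_gt0 := period_gt0 m_0 m_n1.
(* Large enough for [k0 + j * period < Q * period], whatever [j <= N] the dependence provides. *)
pose Q := (k0.+1 + N)%N.
have [c c_neq0 sum0] := ffun_dependent (fun j : 'I_N.+1 => v ((Q - j) * period)%N).
pose s (j : 'I_N.+1) k := if (k < j * period)%N then 0 else v (k - j * period)%N.
have s0 (j : 'I_N.+1) k : (k <= j * period)%N -> s j k = 0.
  by rewrite /s; case: ltnP => // le le'; rewrite (_ : (k - _)%N = 0%N) //; lia.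
have chs j : chain p (s j).
  move=> k; rewrite {2}/s; case: ltnP => lt.
    by rewrite s0; [exact: step0|lia].
  have [e|lt'] := eqVneq k.+1 (j * period)%N.
    rewrite e subnn v0 s0; [exact: step0|lia].
  rewrite /s ifN; last by lia.
  have := chv (k - j * period)%N.
  rewrite -[X in step X](iter_add_period _ j) subnK; last by lia.
  by rewrite subSn //; lia.
pose w k := if (Q * period <= k)%N then 0 else \sum_j c j *: s j k.
have sum_s : \sum_j c j *: s j (Q * period)%N = 0.
  rewrite -[RHS]sum0; apply: eq_bigr => j _; rewrite /s ifN; first by rewrite mulnBl.
  by have := ltn_ord j; rewrite /Q; nia.
have chw : chain p w.
  have ch := @chain_sum p 'I_N.+1 predT c s (fun i _ _ => chs i).
  move=> k; rewrite /w; case: (leqP _ k) => le.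
    by rewrite ifT; [exact: step0|lia].
  case: (leqP _ k.+1) => le'; last exact: ch.
  by have := ch k; rewrite (_ : k.+1 = (Q * period)%N) ?sum_s //; lia.
have w0 : forall k, w k = 0.
  apply: (finite_chain_eq0 chw (K := (Q * period)%N)).
    rewrite /w; case: ifP => // _; apply: big1 => j _; rewrite s0 ?scaler0 //; lia.
  by move=> k le; rewrite /w le.
have [j cj minj] := min_nonzero c_neq0.
have H k : (k + j * period < Q * period)%N -> v k = 0.
  elim/ltn_ind: k => k IHk lt.
  have := w0 (k + j * period)%N; rewrite /w leqNgt lt (bigD1 j isT) big1.
    rewrite /s ifN; last by lia.
    by rewrite /= addr0 addnK => /eqP; rewrite scaler_eq0 (negPf cj) => /eqP.
  move=> j' /andP[_ ne]; have [ltj|le] := ltnP j' j; first by rewrite minj ?scale0r.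
  have lt_jj' : (j < j')%N by rewrite ltn_neqAle le andbT eq_sym val_eqE.
  rewrite /s; case: ltnP => le'; first by rewrite scaler0.
  have le_P : (period + j * period <= j' * period)%N.
    by rewrite -mulSn leq_mul2r lt_jj' orbT.
  by rewrite IHk ?scaler0 //; lia.
apply: H; have lt_j : (j <= N)%N by rewrite -ltnS; exact: ltn_ord.
have : (j * period <= N * period)%N by rewrite leq_mul2r lt_j orbT.
have : (k0.+1 <= k0.+1 * period)%N by exact: leq_pmulr.
by rewrite /Q mulnDl; lia.
Qed.

End Chains.

(** * A basis adapted to the walk *)

Section Basis.
Variables (n : nat) (m : nat -> nat).
Hypotheses (m_0 : m 0%N = 0%N) (m_n1 : m n.+1 = 0%N).
Local Notation vtx := (vertex n m).
Local Notation walk := (@walk n m).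
Local Notation period := (period m_0 m_n1).
Local Notation par := (par m_0 m_n1).
Local Notation idx := (idx m_0 m_n1).
Local Notation first := (first m_0 m_n1).
Implicit Types w q p : vtx.
Variables (F : fieldType) (u d : vtx -> vtx -> F).
Hypothesis charF : [pchar F] =i pred0.
Local Notation V := {ffun vtx -> F^o}.
Local Notation step := (step u d).
Hypothesis u_level : forall q q', level q' != (level q).+1 -> u q q' = 0.
Hypothesis d_level : forall q q', level q' != (level q).+1 -> d q q' = 0.
Hypothesis du0 : forall f : V, appl d (appl u f) = 0.
Hypothesis regular : forall p, exists2 D : {poly F}, D != 0 &
  forall tau, D.[tau] != 0 -> band_det m_0 m_n1 u d tau p != 0.

Lemma step_same w w' f f' : level w = level w' -> goes_up w = goes_up w' ->
  step w f f' -> step w' f f'.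
Proof.
move=> lw gw [sf sf' e]; have [lw' _] := walk_level m_0 m_n1 gw lw.
by split; [rewrite -lw|rewrite -lw'|rewrite -gw].
Qed.

Section WeightedFamily.
Variables (b : vtx -> V) (s : vtx -> F).
Hypothesis s_neq0 : forall w, s w != 0.
Hypothesis step_b : forall w, step w (b w) (s w *: b (walk w)).

Definition weight w k := \prod_(j < k) s (iter j walk w).

Lemma weight_neq0 w k : weight w k != 0.
Proof. by apply/prodf_neq0 => j _; exact: s_neq0. Qed.

Lemma weightS w k : weight w k.+1 = weight w k * s (iter k walk w).
Proof. exact: big_ord_recr. Qed.

Lemma weight0 w : weight w 0 = 1.
Proof. exact: big_ord0. Qed.

Lemma weightD w j k : weight w (j + k) = weight w j * weight (iter j walk w) k.
Proof.
elim: k => [|k IHk]; first by rewrite addn0 weight0 mulr1.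
by rewrite addnS !weightS IHk mulrA -iterD addnC.
Qed.

(** The accumulated weight absorbs the scalars of [step_b], so that consecutive vectors are related
    without factors. *)
Definition orbit_chain w k : V := weight w k *: b (iter k walk w).

Lemma chain_orbit w : chain u d w (orbit_chain w).
Proof.
move=> k; rewrite /orbit_chain weightS -scalerA; apply: stepZ; exact: step_b.
Qed.

Lemma chain_orbit_par w w' : par w w' -> chain u d w' (orbit_chain w).
Proof.
move=> pww' k; apply: (@step_same (iter k walk w)); last exact: chain_orbit.
  exact: par_level (par_iter k pww').
exact: par_up (par_iter k pww').
Qed.

(* Where the two walks separate, [w] goes up and [v] goes down, so that the
   vector of [w] is in the image of [u], which [d] kills. *)
Lemma chain_stop v w : level w = level v -> (pos w < pos v)%N ->
  chain u d v (fun k => if [forall j : 'I_k,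
    goes_up (iter j walk w) == goes_up (iter j walk v)] then orbit_chain w k else 0).
Proof.
move=> lwv ltwv k; case: ifPn => [/forallP agree|nagree]; last first.
  rewrite ifN; first exact: step0.
  apply: contra nagree => /forallP agree; apply/forallP=> j.
  by have := agree (widen_ord (leqnSn k) j).
have agree' j : (j < k)%N -> goes_up (iter j walk w) = goes_up (iter j walk v).
  by move=> ltj; exact: (eqP (agree (Ordinal ltj))).
have [lk pk] := agree_iter m_0 m_n1 lwv agree'.
have chw := chain_orbit w k.
case: ifPn => [/forallP agree2|nagree].
  by apply: step_same chw => //; exact: (eqP (agree2 ord_max)).
have neq : goes_up (iter k walk w) != goes_up (iter k walk v).
  apply: contra nagree => eqk; apply/forallP=> j.
  have [ltj|le] := ltnP j k; first by rewrite agree'.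
  by have -> : j = k :> nat by have := ltn_ord j; lia.
have [up_w down_v] : goes_up (iter k walk w) /\ ~~ goes_up (iter k walk v).
  by move: neq; rewrite /goes_up lk; split; lia.
case: chw => sf sf'; rewrite up_w => e; split; [by rewrite -lk|exact: supp0|].
by rewrite (negPf down_v) e du0.
Qed.

Hypothesis class_free : forall w0 (c : vtx -> F),
  \sum_(w | par w w0) c w *: b w = 0 -> forall w, par w w0 -> c w = 0.

(** Let [v] be the lowest vertex with nonzero coefficient. A chain that runs along the class of [v]
    and arrives at the share of this class in the relation is continued by minus the share of the
    other vertices, which stops; hence the share of the class is 0. *)
Lemma level_free i (c : vtx -> F) :
  \sum_(w | level w == i) c w *: b w = 0 -> forall w, level w = i -> c w = 0.
Proof.
move=> sum0 w0 lw0; apply/eqP; apply: contraT => cw0.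
pose A w := (level w == i) && (c w != 0).
have Aw0 : A w0 by rewrite /A lw0 eqxx.
case: (@arg_maxnP _ w0 A (fun w => pos w) Aw0) => v /andP[/eqP lv cv] maxv.
(* From this step on [ending_chain_eq0] gives zero; and, being a multiple of the period, [M] steps
   bring every walk home. *)
pose M := (#|vtx| * period)%N.
have iterM w : iter M walk w = w by exact: iter_period_mul.
pose B w k := if [forall j : 'I_k, goes_up (iter j walk w) == goes_up (iter j walk v)]
  then orbit_chain w k else 0.
(* The division compensates for the weight gathered in the first [M] steps. *)
pose c1 w := c w / weight w M.
pose high k := \sum_(w | par w v) c1 w *: orbit_chain w k.
pose low k := \sum_(w | (level w == i) && ~~ par w v) (- c w) *: B w k.
have chh : chain u d v high.
  by apply: chain_sum => w pw _; exact: chain_orbit_par.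
have chl : chain u d v low.
  apply: chain_sum => w /andP[/eqP lw npw]; rewrite oppr_eq0 => cw.
  have ltw : (pos w < pos v)%N.
    have le_wv : (pos w <= pos v)%N by apply: maxv; rewrite /A lw eqxx.
    rewrite ltn_neqAle le_wv andbT.
    apply: contra npw => /eqP pw; suff -> : w = v by exact: par_refl.
    by apply: vertex_inj; rewrite ?lw.
  by apply: chain_stop => //; rewrite lw.
have highM : high M = \sum_(w | par w v) c w *: b w.
  apply: eq_bigr => w _.
  by rewrite /orbit_chain iterM scalerA mulfVK ?weight_neq0.
have low0 : low 0%N = high M.
  have B0 w : B w 0%N = b w.
    by rewrite /B ifT; [rewrite /orbit_chain weight0 scale1r|apply/forallP=> -[]].
  rewrite highM /low; move/eqP: sum0; rewrite (bigID (fun w => par w v)) /=.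
  rewrite addr_eq0 => /eqP e; under [LHS]eq_bigr do rewrite B0 scaleNr.
  rewrite sumrN -e; apply: eq_bigl => w.
  by rewrite andb_idl // => /par_level->; rewrite lv eqxx.
have low_end k : (period <= k)%N -> low k = 0.
  move=> le_k; apply: big1 => w /andP[/eqP lw npw]; rewrite /B ifN ?scaler0 //.
  apply: contra npw => /forallP agree; apply/andP; split; first by rewrite lw lv.
  apply/forallP=> j; exact: (agree (widen_ord le_k j)).
pose vv k := if (k < M)%N then high k else low (k - M)%N.
have chv : chain u d v vv.
  move=> k; rewrite /vv; case: ltnP => lt.
    have := chh k; have [e|lt'] := eqVneq k.+1 M; first by rewrite e ltnn subnn low0.
    by rewrite ltn_neqAle lt' lt.
  rewrite ltnNge (leqW lt) /= subSn //.
  by have := chl (k - M)%N; rewrite -[X in step X](iter_add_period m_0 m_n1 _ #|vtx|) subnK.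
have : vv M = 0.
  apply: (ending_chain_eq0 charF regular chv (K := (M + period)%N)) => // k le_k.
  by rewrite /vv ifN ?low_end //; lia.
rewrite /vv ltnn subnn low0 highM => /class_free/(_ v (par_refl _ _ _)) /eqP.
by rewrite (negPf cv).
Qed.

End WeightedFamily.

Hypothesis roots : forall p, exists rs : seq F,
  [/\ uniq rs, size rs = class_size m_0 m_n1 p &
    {in rs, forall tau, band_det m_0 m_n1 u d tau p = 0 /\ tau != 0}].

Lemma band_homs_exist : exists t : vtx -> nat -> F, exists z : vtx -> nat -> vtx -> V,
  (forall p, {in gtn (class_size m_0 m_n1 p) &, injective (t p)}) /\
  forall p j, (j < class_size m_0 m_n1 p)%N ->
    [/\ t p j != 0, band_hom u d (t p j) p (z p j) &
        exists2 w, fconnect walk p w & z p j w != 0].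
Proof.
have /fin_all_exists[rs rsP] := roots.
pose t p j := (rs p)`_j.
have zP p : exists z : nat -> vtx -> V, forall j, (j < class_size m_0 m_n1 p)%N ->
    [/\ t p j != 0, band_hom u d (t p j) p (z j) &
        exists2 w, fconnect walk p w & z j w != 0].
  have [uniq_rs size_rs rs0] := rsP p.
  have /fin_all_exists[zz zzP] (j : 'I_(class_size m_0 m_n1 p)) :
      exists z : vtx -> V, [/\ t p j != 0, band_hom u d (t p j) p z &
        exists2 w, fconnect walk p w & z w != 0].
    have [|det0 t_neq0] := rs0 (t p j); first by rewrite mem_nth ?size_rs.
    by have [z hz nz] := band_hom_exists u_level d_level det0; exists z.
  (* The family is 0 by default; the claim only concerns indices below the size of the class. *)
  exists (fun j => if insub j is Some j' then zz j' else fun=> 0) => j lt_j.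
  by rewrite insubT; exact: (zzP (Ordinal lt_j)).
have /fin_all_exists[z zzP] := zP.
exists t, z; split=> // p j j' ltj ltj' e.
have [uniq_rs size_rs _] := rsP p.
by apply/eqP; rewrite -(nth_uniq 0 _ _ uniq_rs) ?size_rs //; apply/eqP.
Qed.

(** The vector of [w] is the value at [first w] of the homomorphism whose scalar is the root in tau
    of index [idx w]. All vertices of a class thus use one band system with distinct scalars, and a
    relation inside a class, followed through repeated turns, involves the powers of these
    scalars. *)
Lemma band_basis : exists (b : vtx -> V) (s : vtx -> F),
  [/\ forall w, s w != 0, forall w, step w (b w) (s w *: b (walk w)) &
  forall i (c : vtx -> F), \sum_(w | level w == i) c w *: b w = 0 ->
    forall w, level w = i -> c w = 0].
Proof.
have [t [z [t_inj zP]]] := band_homs_exist.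
have inj := walk_inj m_0 m_n1.
have csym := fconnect_sym inj.
pose root w := froot walk (first w).
have conn w : fconnect walk (root w) (first w) by rewrite csym; exact: connect_root.
have root_walk w : root (walk w) = root w.
  by rewrite /root first_walk; apply/esym/(fingraph.rootP csym); exact: fconnect1.
have idx_lt' w : (idx w < class_size m_0 m_n1 (root w))%N.
  have -> : class_size m_0 m_n1 (root w) = class_size m_0 m_n1 w.
    have [pf _] := firstP m_0 m_n1 w; rewrite -(class_size_par pf).
    have /iter_findex <- := conn w.
    elim: (findex _ _ _) => //= k ->; by rewrite class_size_walk.
  exact: idx_lt.
pose b w := z (root w) (idx w) (first w).
pose s w := twist (t (root w) (idx w)) (root w) (walk (first w)).
have s_neq0 w : s w != 0.
  rewrite /s /twist; case: ifP => _; last exact: oner_neq0.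
  by have [] := zP _ _ (idx_lt' w).
have step_b w : step w (b w) (s w *: b (walk w)).
  have [pf _] := firstP m_0 m_n1 w.
  apply: (@step_same (first w)); [exact: par_level pf|exact: par_up pf|].
  rewrite /b root_walk idx_walk first_walk.
  by have [_ hz _] := zP _ _ (idx_lt' w); exact: hz.
exists b, s; split=> //; apply: (level_free s_neq0 step_b).
(* One turn gathers exactly the scalar tau, since only the edge closing the orbit is twisted. *)
have weight_order w : first w = root w ->
    weight s w (fingraph.order walk (root w)) = t (root w) (idx w).
  move=> fw; set l := fingraph.order _ _.
  have rootk k : root (iter k walk w) = root w.
    by elim: k => // k IHk; rewrite iterS root_walk.
  have idxk k : idx (iter k walk w) = idx w.
    by elim: k => // k IHk; rewrite iterS idx_walk.
  have firstk k : first (iter k walk w) = iter k walk (root w).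
    by elim: k => // k IHk; rewrite iterS first_walk IHk.
  have l_gt0 : (0 < l)%N by exact: fingraph.order_gt0.
  have sk k : (k < l)%N ->
      s (iter k walk w) = if k.+1 == l then t (root w) (idx w) else 1.
    move=> ltk; rewrite /s rootk idxk firstk /twist -iterS; case: eqP => [e|ne].
      rewrite ifT // eqn_leq ltk leqNgt; apply/negP => /findex_iter.
      by rewrite e findex0.
    rewrite ifN //; apply/eqP => e; apply: ne; rewrite e; exact: iter_order.
  rewrite /weight -(prednK l_gt0) big_ord_recr /= big1 ?mul1r.
    by rewrite sk prednK ?eqxx.
  move=> j _; rewrite sk; last by have := ltn_ord j; lia.
  by rewrite ifN //; have := ltn_ord j; lia.
(* If [b w] were 0, the chain starting there would be 0 at every step, although the homomorphism is
   nonzero somewhere on the orbit. *)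
have b_neq0 w : first w = root w -> b w != 0.
  move=> fw; apply: contraTneq isT => bw0.
  have [_ hz [w' /iter_findex w'E]] := zP _ _ (idx_lt' w).
  have ch0 : forall k, orbit_chain b s w k = 0.
    apply: (starting_chain_eq0 charF regular (chain_orbit step_b w)).
    by rewrite /orbit_chain bw0 scaler0.
  set k := findex _ _ _ in w'E; have := ch0 k => /eqP.
  rewrite scaler_eq0 (negPf (weight_neq0 s_neq0 _ _)) /= => /eqP.
  have rootk : root (iter k walk w) = root w.
    by elim: (k) => // k' IHk; rewrite iterS root_walk.
  have idxk : idx (iter k walk w) = idx w.
    by elim: (k) => // k' IHk; rewrite iterS idx_walk.
  have firstk : first (iter k walk w) = iter k walk (root w).
    by elim: (k) => // k' IHk; rewrite iterS first_walk IHk.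
  by rewrite /b rootk idxk firstk w'E => -> /eqP.
move=> w0 c sum0 w pw.
(* [k0] steps lead from [first w0] to the chosen vertex of its orbit, from which full turns are
   counted. *)
have [k0 fk0] : exists k, iter k walk (first w0) = root w0.
  exists (findex walk (first w0) (root w0)).
  by apply: iter_findex; exact: connect_root.
set p := root w0 in fk0.
have iterp k w' : par w' w0 -> [/\ first (iter k walk w') = iter k walk (first w0),
    root (iter k walk w') = p & idx (iter k walk w') = idx w'].
  move=> pw'; elim: k => [|k [IH1 IH2 IH3]]; first by rewrite /p /root (first_par pw').
  by rewrite !iterS first_walk IH1 root_walk IH2 idx_walk IH3.
pose l := fingraph.order walk p.
have iterl j w' : par w' w0 -> first (iter (k0 + j * l) walk w') = p.
  move=> pw'; have [-> _ _] := iterp (k0 + j * l)%N _ pw'.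
  rewrite addnC iterD fk0; elim: j => // j IHj.
  by rewrite mulSn iterD IHj; exact: iter_order.
have weightl j w' : par w' w0 ->
    weight s w' (k0 + j * l) = weight s w' k0 * t p (idx w') ^+ j.
  move=> pw'; elim: j => [|j IHj]; first by rewrite addn0 expr0 mulr1.
  rewrite mulSn [(l + _)%N]addnC addnA weightD IHj exprSr mulrA; congr (_ * _).
  have [_ r1 i1] := iterp (k0 + j * l)%N _ pw'.
  have := @weight_order (iter (k0 + j * l) walk w').
  by rewrite r1 i1 iterl //; apply.
have ch : chain u d w0 (fun k => \sum_(w' | par w' w0) c w' *: orbit_chain b s w' k).
  by apply: chain_sum => w' pw' _; exact: chain_orbit_par.
(* The relation is the value at step 0 of a chain, so its transports along the walk vanish as
   well. *)
have ch0 k : \sum_(w' | par w' w0) c w' *: orbit_chain b s w' k = 0.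
  apply: (starting_chain_eq0 charF regular ch); rewrite -[RHS]sum0; apply: eq_bigr => w' _.
  by rewrite /orbit_chain weight0 scale1r.
have tp_inj : {in (fun w' => par w' w0) &, injective (fun w' => t p (idx w'))}.
  move=> w1 w2 p1 p2 /= e; have p12 : par w1 w2.
    by apply: par_trans p1 _; rewrite par_sym.
  apply: (idx_inj p12); apply: (t_inj p) => //; rewrite inE.
    by have [_ r1 _] := iterp 0%N _ p1; have := idx_lt' w1; rewrite r1.
  by have [_ r1 _] := iterp 0%N _ p2; have := idx_lt' w2; rewrite r1.
pose y w' := (c w' * weight s w' k0) *: z p (idx w') p.
have yw : y w = 0.
  apply: (sum_pow_eq0 tp_inj _ pw) => j; rewrite -[RHS](ch0 (k0 + j * l)%N).
  apply: eq_bigr => w' pw'; rewrite /y /orbit_chain weightl // !scalerA.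
  have [_ r1 i1] := iterp (k0 + j * l)%N _ pw'.
  by rewrite /b r1 i1 iterl // mulrC mulrA.
move/eqP: yw; rewrite scaler_eq0 mulf_eq0 (negPf (weight_neq0 s_neq0 _ _)) orbF.
have [f1 r1 i1] := iterp k0 _ pw; rewrite fk0 in f1.
have := b_neq0 (iter k0 walk w); rewrite /b r1 i1 f1 => /(_ erefl)/negPf->.
by rewrite orbF => /eqP.
Qed.

End Basis.

(** * A point of the component that satisfies the generic condition *)

Lemma rank_leq_rows (F : fieldType) p q (A : 'M[F]_(p, q)) (P : {set 'I_p}) :
  (forall r s, r \notin P -> A r s = 0) -> (\rank A <= #|P|)%N.
Proof.
move=> A0; have sub : (A <= \sum_(r in P) <<row r A>>)%MS.
  apply/row_subP=> r; case: (boolP (r \in P)) => rP.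
    by apply: (sumsmx_sup r) => //; rewrite genmxE.
  by rewrite (_ : row r A = 0) ?sub0mx //; apply/rowP=> s; rewrite !mxE A0.
apply: leq_trans (mxrankS sub) _; apply: leq_trans (mxrank_sum_leqif _) _.
rewrite -sum1_card /=; apply: leq_sum => r _.
by rewrite genmxE; exact: rank_leq_row.
Qed.

Section WeightedModules.
Variables (n : nat) (m : nat -> nat).
Hypotheses (m_0 : m 0%N = 0%N) (m_n1 : m n.+1 = 0%N).
Local Notation vtx := (vertex n m).
Local Notation walk := (@walk n m).
Local Notation period := (period m_0 m_n1).
Local Notation par := (par m_0 m_n1).
Implicit Types w q p : vtx.
Variables (F : fieldType).
Local Notation V := {ffun vtx -> F^o}.

Lemma card_ord_lt (p k : nat) : (#|[set r : 'I_p | (r < k)%N]| <= k)%N.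
Proof.
case: k => [|k]; first by rewrite leqn0 cards_eq0; apply/eqP/setP=> r; rewrite !inE.
rewrite -[X in (_ <= X)%N](card_ord k.+1).
pose f (r : 'I_p) : 'I_k.+1 := inord r.
rewrite -(@card_in_imset _ _ f); first exact: max_card.
move=> r r'; rewrite !inE => ltr ltr' /(congr1 (@nat_of_ord _)).
by rewrite !inordK // => /val_inj.
Qed.

Section Weights.
Variables cu cl : vtx -> F.

Definition weighted_rep : quiver_rep F n (band_dim m) :=
  let up (i : 'I_n) : 'M[F]_(band_dim m i, band_dim m i.+1) := \matrix_(r, s)
    if upper_edge (source_vertex s) (target_vertex r) then cu (source_vertex s) else 0 in
  let lo (i : 'I_n) : 'M[F]_(band_dim m i, band_dim m i.+1) := \matrix_(r, s)
    if lower_edge (source_vertex s) (target_vertex r) then cl (source_vertex s) else 0 in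
  QuiverRep (fun i => if odd (n - i.+1) then lo i else up i)
            (fun i => if odd (n - i.+1) then up i else lo i).

Lemma upper_arrow_weighted i r s : upper_arrow weighted_rep i r s =
  if upper_edge (source_vertex s) (target_vertex r) then cu (source_vertex s) else 0.
Proof. by rewrite /upper_arrow /=; case: (odd _); rewrite mxE. Qed.

Lemma lower_arrow_weighted i r s : lower_arrow weighted_rep i r s =
  if lower_edge (source_vertex s) (target_vertex r) then cl (source_vertex s) else 0.
Proof. by rewrite /lower_arrow /=; case: (odd _); rewrite mxE. Qed.

Lemma arrow_vertices q q' : level q' = (level q).+1 ->
  exists (i : 'I_n) r s, q = @target_vertex n m i r /\ q' = @source_vertex n m i s.
Proof.
move=> lq'; have lt : (level q < n)%N by rewrite -lq'; exact: level_le.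
exists (Ordinal lt).
have [r qE] := @target_vertexP _ _ m_0 m_n1 q (Ordinal lt) erefl.
have [s q'E] := @source_vertexP _ _ m_0 m_n1 q' (Ordinal lt) lq'.
by exists r, s.
Qed.

Lemma upper_coef_weighted q q' :
  upper_coef weighted_rep q q' = if upper_edge q' q then cu q' else 0.
Proof.
have [lq'|lq'] := eqVneq (level q') (level q).+1.
  have [i [r [s [-> ->]]]] := arrow_vertices lq'.
  by rewrite /upper_coef arrow_coefE upper_arrow_weighted.
rewrite /upper_coef arrow_coef_level // ifN //.
by apply: contra lq' => /upper_edgeP[/eqP].
Qed.

Lemma lower_coef_weighted q q' :
  lower_coef weighted_rep q q' = if lower_edge q' q then cl q' else 0.
Proof.
have [lq'|lq'] := eqVneq (level q') (level q).+1.
  have [i [r [s [-> ->]]]] := arrow_vertices lq'.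
  by rewrite /lower_coef arrow_coefE lower_arrow_weighted.
rewrite /lower_coef arrow_coef_level // ifN //.
by apply: contra lq' => /lower_edgeP[/eqP].
Qed.

(** A vertex between an upper and a lower edge would have both [pos] and [copos] too small for the
    size of its level, so the mixed products vanish. The ranks are bounded by the number of rows
    that meet an edge. *)
Lemma weighted_in_component : band_component weighted_rep.
Proof.
have rank_up i : (\rank (upper_arrow weighted_rep i) <= m i.+1)%N.
  apply: leq_trans (card_ord_lt (band_dim m i) (m i.+1)).
  apply: rank_leq_rows => r s; rewrite inE upper_arrow_weighted => nr.
  rewrite ifN //; apply: contra nr => /upper_edgeP[_ pr].
  by rewrite pr.
have rank_lo i : (\rank (lower_arrow weighted_rep i) <= m i.+1)%N.
  apply: leq_trans (card_ord_lt (band_dim m i) (m i.+1)).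
  rewrite -(card_preimset _ (@rev_ord_inj (band_dim m i))).
  apply: rank_leq_rows => r s; rewrite !inE lower_arrow_weighted => nr.
  rewrite ifN //; apply: contra nr => /lower_edgeP[_ cr].
  by rewrite cr.
split.
  apply/(in_Rep_arrows m_0 m_n1) => i h; split; apply/matrixP=> r s; rewrite !mxE;
    apply: big1 => j _.
    rewrite upper_arrow_weighted; case: ifP; rewrite ?mul0r //.
    rewrite (lower_arrow_weighted (i := Ordinal h)); case: ifP; rewrite ?mulr0 //.
    move=> /lower_edgeP[_ ce lte] /upper_edgeP[_ pe lte'].
    have := pos_copos m_0 m_n1 (target_vertex (j : 'I_(band_dim m (Ordinal h)))).
    rewrite ce in lte.
    have ls : level (source_vertex s) = i.+2 by [].
    have lj : level (target_vertex (j : 'I_(band_dim m (Ordinal h)))) = i.+1 by [].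
    have lj' : level (source_vertex j) = i.+1 by [].
    have pj : pos (source_vertex j) = pos (target_vertex (j : 'I_(band_dim m (Ordinal h)))) by [].
    move: lte lte'; rewrite ls lj lj' pj => lte lte' e; exfalso.
    set x := copos _ in lte e; set y := pos _ in lte' e; lia.
  rewrite lower_arrow_weighted; case: ifP; rewrite ?mul0r //.
  rewrite (upper_arrow_weighted (i := Ordinal h)); case: ifP; rewrite ?mulr0 //.
  move=> /upper_edgeP[_ pe lte] /lower_edgeP[_ ce lte'].
  have := pos_copos m_0 m_n1 (target_vertex (j : 'I_(band_dim m (Ordinal h)))).
  have ls : level (source_vertex s) = i.+2 by [].
  have lj : level (target_vertex (j : 'I_(band_dim m (Ordinal h)))) = i.+1 by [].
  have lj' : level (source_vertex j) = i.+1 by [].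
  have cj : copos (source_vertex j) = copos (target_vertex (j : 'I_(band_dim m (Ordinal h)))) by [].
  move: lte lte'; rewrite pe ls lj lj' cj => lte lte' e; exfalso.
  set x := copos _ in lte' e; set y := pos _ in lte e; lia.
move=> i; have := rank_up i; have := rank_lo i; rewrite /upper_arrow /lower_arrow.
by case: (odd _).
Qed.

End Weights.

Section Model.
Hypothesis charF : [pchar F] =i pred0.
Variable kappa : vtx -> nat.
Hypothesis kappa_walk : forall w, kappa (walk w) = kappa w.
Hypothesis kappa_gt1 : forall w, (1 < kappa w)%N.
Hypothesis kappa_inj : forall w q, kappa w = kappa q -> fconnect walk w q.

(** With inverse weights on the lower edges, every step of the walk obeys the same rule, up or down:
    the coordinate at [q] is [kappa q] times the next one. *)
Definition model : quiver_rep F n (band_dim m) :=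
  weighted_rep (fun w => (kappa w)%:R) (fun w => (kappa w)%:R^-1).
Local Notation u := (upper_coef model).
Local Notation d := (lower_coef model).
Local Notation k_ w := ((kappa w)%:R : F).

Lemma kappa_neq0 w : k_ w != 0.
Proof. by rewrite ((pcharf0P _).1 charF) -lt0n ltnW. Qed.

Lemma kappa_iter k w : kappa (iter k walk w) = kappa w.
Proof. by elim: k => //= k <-; rewrite kappa_walk. Qed.

Lemma appl_upper_model (f : V) q :
  appl u f q = if goes_up q then k_ q * f (walk q) else 0.
Proof.
rewrite ffunE (bigD1 (walk q)) //= upper_coef_weighted upper_edge_walk // eqxx andbT.
rewrite big1 ?addr0; first by case: ifP; rewrite ?mul0r ?kappa_walk.
move=> q' ne; rewrite upper_coef_weighted upper_edge_walk // (negPf ne) andbF.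
by rewrite mul0r.
Qed.

Lemma appl_lower_model (f : V) q :
  appl d f (walk q) = if goes_up q then 0 else (k_ q)^-1 * f q.
Proof.
rewrite ffunE (bigD1 q) //= lower_coef_weighted lower_edge_walk // eqxx andbT.
rewrite big1 ?addr0; first by case: (goes_up q); rewrite ?mul0r.
move=> q' ne; rewrite lower_coef_weighted lower_edge_walk //.
rewrite (inj_eq (walk_inj m_0 m_n1)) eq_sym (negPf ne) andbF.
by rewrite mul0r.
Qed.

Lemma step_model_same w f f' q : step u d w f f' -> goes_up w = goes_up q ->
  f q = k_ q * f' (walk q).
Proof.
case=> _ _ + e; rewrite e; case: ifP => up_q ->.
  by rewrite appl_upper_model up_q.
by rewrite appl_lower_model up_q mulrA mulfV ?kappa_neq0 ?mul1r.
Qed.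

Lemma band_det_model p : band_det m_0 m_n1 u d 1 p != 0.
Proof.
apply/eqP => /(band_hom_exists (@arrow_coef_level _ _ _ _) (@arrow_coef_level _ _ _ _)).
case=> z hz [w0 pw0]; apply/negP; rewrite negbK; apply/eqP.
have inj := walk_inj m_0 m_n1.
have hz' w k : fconnect walk p w ->
    step u d (iter k walk w) (z (iter k walk w)) (z (iter k.+1 walk w)).
  move=> pw; have pk : fconnect walk p (iter k walk w).
    by apply: connect_trans pw _; exact: fconnect_iter.
  by have := hz _ pk; rewrite /twist if_same scale1r.
have run w q k : fconnect walk p w ->
    (forall j, (j < k)%N -> goes_up (iter j walk w) = goes_up (iter j walk q)) ->
    z w q = k_ q ^+ k * z (iter k walk w) (iter k walk q).
  move=> pw; elim: k => [|k IHk] agree; first by rewrite mul1r.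
  rewrite IHk; last by move=> j ltj; apply: agree; exact: ltnW.
  rewrite (step_model_same (hz' w k pw)); last exact: agree.
  by rewrite kappa_iter mulrA -exprSr.
suff z0 w q : fconnect walk p w -> z w q = 0.
  by apply/ffunP=> q; rewrite ffunE z0.
move=> pw; have [lwq|lwq] := eqVneq (level q) (level w); last first.
  by have [sz _ _] := hz' w 0%N pw; exact: sz.
case: (boolP (par w q)) => [/parP[_ same]|npar].
  (* A full period multiplies the coordinate by a power of an integer greater than 1, which differs
     from 1 in characteristic 0. *)
  have := run w q period pw (fun j _ => same j); rewrite !iter_period => /eqP.
  rewrite -subr_eq0 -{1}[z w q]mul1r -mulrBl mulf_eq0 => /orP[|/eqP //].
  rewrite -oppr_eq0 opprB -natrX -[X in _ - X]mulr1n -natrB ?expn_gt0 1?ltnW ?kappa_gt1 //.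
  rewrite ((pcharf0P _).1 charF) subn_eq0 leqNgt -{1}(exp1n period).
  by rewrite ltn_exp2r ?kappa_gt1 ?period_gt0.
have [ltwq|ltqw|e] := ltngtP (pos w) (pos q).
(* At the split the vector lies in the image of [u], which has no coordinate at a vertex that goes
   down. *)
- have [k agree /andP[up_w down_q]] := not_par_split (esym lwq) ltwq npar.
  rewrite (run w q k pw agree); have [_ _] := hz' w k pw.
  by rewrite up_w => ->; rewrite appl_upper_model (negPf down_q) mulr0.
(* Just after the last disagreement the vector lies in the image of [d], which has no coordinate at
   a vertex entered by an upper edge. *)
- rewrite par_sym in npar.
  have [k [ltk /andP[up_q down_w] _ agree]] := not_par_join lwq ltqw npar.
  have pw' : fconnect walk p (iter k.+1 walk w).
    by apply: connect_trans pw _; exact: fconnect_iter.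
  have [_ _] := hz' w k pw; rewrite (negPf down_w) => e.
  have := @run _ (iter k.+1 walk q) (period - k.+1)%N pw'.
  rewrite -!iterD subnK // !iter_period e appl_lower_model up_q => run_end.
  have : k_ (iter k.+1 walk q) ^+ (period - k.+1) * z w q = 0.
    apply/esym/run_end => j ltj; rewrite -!iterD; apply/esym/agree; lia.
  by move/eqP; rewrite mulf_eq0 expf_eq0 (negPf (kappa_neq0 _)) andbF => /eqP.
by case/negP: npar; rewrite (vertex_inj (esym lwq) e) par_refl.
Qed.

Definition delta q : V := [ffun q' => (q' == q)%:R].

Lemma step_delta w q : par w q -> step u d w (delta q) ((k_ q)^-1 *: delta (walk q)).
Proof.
move=> pwq; have inj := walk_inj m_0 m_n1.
have lq := par_level pwq; have lq' := par_level (par_iter 1 pwq).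
split.
- by move=> q' ne; rewrite ffunE; case: (q' =P q) ne => // ->; rewrite lq eqxx.
- move=> q' ne; rewrite !ffunE; case: (q' =P walk q) ne => [->|_ _]; last exact: mulr0.
  by rewrite -[walk w]/(iter 1 walk w) lq' eqxx.
rewrite (par_up pwq); case: ifPn => up_q; apply/ffunP=> q'.
  rewrite appl_upper_model !ffunE (inj_eq inj); case: eqP => [->|ne].
    by rewrite up_q -[_ *: _]/(_ * _) mulr1 mulfV ?kappa_neq0.
  by rewrite -[_ *: _]/(_ * _) !mulr0; case: ifP.
have -> : q' = walk (finv walk q') by rewrite f_finv.
rewrite appl_lower_model !ffunE (inj_eq inj); case: eqP => [->|ne].
  by rewrite (negPf up_q).
by rewrite -[_ *: _]/(_ * _) !mulr0; case: ifP.
Qed.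

(** The basis vectors along the walk of [q], scaled by one more factor of the inverse of [kappa q]
    at each step, form a nonzero homomorphism from the band of [p]. *)
Lemma band_det_model_root p q : par q p ->
  band_det m_0 m_n1 u d ((k_ q)^-1 ^+ fingraph.order walk p) p = 0.
Proof.
rewrite par_sym => ppq; set l := fingraph.order walk p; set tau := _ ^+ l.
have inj := walk_inj m_0 m_n1.
apply/eqP; apply: contraT => det_neq0.
pose z w : V := (k_ q)^-1 ^+ findex walk p w *: delta (iter (findex walk p w) walk q).
have hz : band_hom u d tau p z.
  move=> w pw; rewrite /z; set k := findex walk p w.
  have wE : iter k walk p = w by exact: iter_findex.
  have lt_k : (k < l)%N by exact: findex_max.
  have := stepZ ((k_ q)^-1 ^+ k) (step_delta (par_iter k ppq)).
  rewrite wE kappa_iter scalerA -exprSr -iterS /twist; case: eqP => [wp|wp].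
    have ek : k.+1 = l.
      apply/eqP; rewrite eqn_leq lt_k leqNgt; apply/negP => /findex_iter.
      by rewrite iterS wE wp findex0.
    rewrite wp findex0 ek expr0 scale1r /=.
    by rewrite (par_return ppq (iter_order inj p)).
  have lt_k1 : (k.+1 < l)%N.
    rewrite ltn_neqAle lt_k andbT; apply/eqP => e; apply: wp.
    by rewrite -wE -iterS e; exact: iter_order.
  have -> : findex walk p (walk w) = k.+1 by rewrite -wE -iterS findex_iter.
  by rewrite scale1r.
have := band_hom_eq0 det_neq0 hz (connect0 _ p).
rewrite /z findex0 expr0 scale1r => /ffunP/(_ q); rewrite !ffunE eqxx.
by move/eqP; rewrite oner_eq0.
Qed.

(** Distinct parallel vertices lie on different orbits, hence have different values of [kappa] and
    give different roots. *)
Lemma band_roots_model p : exists rs : seq F,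
  [/\ uniq rs, size rs = class_size m_0 m_n1 p &
    {in rs, forall tau, band_det m_0 m_n1 u d tau p = 0 /\ tau != 0}].
Proof.
have l_gt0 : (0 < fingraph.order walk p)%N by exact: fingraph.order_gt0.
exists [seq (k_ q)^-1 ^+ fingraph.order walk p | q <- enum [set q | par q p]]; split.
- rewrite map_inj_in_uniq ?enum_uniq // => q q'; rewrite !mem_enum !inE => pq pq'.
  rewrite !exprVn => /invr_inj; rewrite -!natrX => /(natr_inj charF)/eqP.
  rewrite eqn_exp2r // => /eqP/kappa_inj.
  by apply: par_fconnect; apply: par_trans pq _; rewrite par_sym; exact: pq'.
- by rewrite size_map -cardE.
move=> tau /mapP[q]; rewrite mem_enum inE => pq ->; split.
  exact: band_det_model_root.
by rewrite expf_neq0 // invr_neq0 // kappa_neq0.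
Qed.

End Model.

Lemma kappa_exists : exists kappa : vtx -> nat, [/\ forall w, kappa (walk w) = kappa w,
  forall w, (1 < kappa w)%N & forall w q, kappa w = kappa q -> fconnect walk w q].
Proof.
have csym := fconnect_sym (walk_inj m_0 m_n1).
exists (fun w => (enum_rank (froot walk w)).+2); split=> // [w|w q [/val_inj/enum_rank_inj]].
  congr (_.+2); congr (enum_rank _ : nat); apply/esym/(fingraph.rootP csym).
  exact: fconnect1.
by move/(fingraph.rootP csym).
Qed.

End WeightedModules.

(** * The generic condition is open and nonempty *)

Section GenericCondition.
Variables (K : fieldType) (L : closedFieldType) (iota : {rmorphism K -> L}).
Variables (n : nat) (m : nat -> nat).
Hypotheses (m_0 : m 0%N = 0%N) (m_n1 : m n.+1 = 0%N).
Hypothesis charL : [pchar L] =i pred0.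
Local Notation rep := (quiver_rep L n (band_dim m)).
Local Notation P := {mpoly K[#|Defs.coord n (band_dim m)|]}.

Definition generic_at (x : rep) (p : vertex n m) :=
  (band_poly m_0 m_n1 x p).[1] != 0 /\
  exists rs : seq L, [/\ uniq rs, size rs = class_size m_0 m_n1 p &
    {in rs, forall tau, (band_poly m_0 m_n1 x p).[tau] = 0 /\ tau != 0}].

(** The witness has two factors: the determinant at tau = 1, which also keeps the polynomial in tau
    nonzero, and a maximal minor of [distinct_roots_mx]. *)
Lemma generic_at_open (x0 : rep) p : generic_at x0 p ->
  exists2 D : P, poly_eval iota D x0 != 0 &
    forall x, poly_eval iota D x != 0 -> generic_at x p.
Proof.
case=> x0_1 [rs0 [uniq0 size0 roots0]].
pose G := band_poly m_0 m_n1 (generic_rep K n m) p.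
pose r := class_size m_0 m_n1 p.
have GE (x : rep) : map_poly (eval_at iota x) G = band_poly m_0 m_n1 x p by exact: map_band_poly.
(* The degree in tau may drop at a point, so the width of the matrix is taken from the generic
   polynomial and fits all specializations. *)
have size_G (x : rep) : (size (band_poly m_0 m_n1 x p) + r <= size G + r)%N.
  by rewrite leq_add2r -(GE x); exact: size_poly.
have free0 : row_free (map_mx (eval_at iota x0) (distinct_roots_mx r (size G + r) G)).
  rewrite map_distinct_roots_mx GE /r -size0; apply: row_free_distinct_roots => //.
  - by apply: contraNneq x0_1 => ->; rewrite horner0.
  - by rewrite size0; exact: size_G.
  by move=> tau /roots0[/eqP root_tau ->]; rewrite andbT.
have [D D_x0 freeD] := row_free_minor free0.
have G1 (x : rep) : eval_at iota x G.[1] = (band_poly m_0 m_n1 x p).[1].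
  by rewrite -(GE x) -[in RHS](rmorph1 (eval_at iota x)) horner_map.
have evE (x : rep) : poly_eval iota (G.[1] * D) x =
    (band_poly m_0 m_n1 x p).[1] * poly_eval iota D x.
  by rewrite -(G1 x) -!eval_atE; exact: rmorphM.
exists (G.[1] * D); first by rewrite evE mulf_neq0 // -eval_atE.
move=> x; rewrite evE mulf_eq0 negb_or => /andP[x_1 D_x]; split; first exact: x_1.
rewrite -eval_atE in D_x; have := freeD _ D_x; rewrite map_distinct_roots_mx GE => free_x.
have [||rs [uniq_rs size_rs roots]] := distinct_roots_of_row_free _ _ free_x.
- by apply: contraNneq x_1 => ->; rewrite horner0.
- exact: size_G.
exists rs; split=> [||tau /roots /andP[/rootP]]; [exact: uniq_rs|exact: size_rs|].
by move=> root_tau ->.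
Qed.

Lemma generic_open (x0 : rep) : (forall p, generic_at x0 p) ->
  exists2 D : P, poly_eval iota D x0 != 0 &
    forall x, poly_eval iota D x != 0 -> forall p, generic_at x p.
Proof.
move=> gen0; have /fin_all_exists2[D D_x0 genD] := fun p => generic_at_open (gen0 p).
exists (\prod_p D p).
  rewrite -eval_atE [eval_at _ _ _]rmorph_prod; apply/prodf_neq0 => p _; exact: D_x0.
move=> x; rewrite -eval_atE [eval_at _ _ _]rmorph_prod => /prodf_neq0 D_x p.
by apply: genD; exact: D_x.
Qed.

Lemma generic_point : exists2 x0 : rep, band_component x0 & forall p, generic_at x0 p.
Proof.
have [kappa [k_walk k_gt1 k_inj]] := kappa_exists m_0 m_n1.
exists (model L kappa); first exact: weighted_in_component.
move=> p; split; first by rewrite horner_band_poly; exact: band_det_model.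
have [rs [uniq_rs size_rs rs0]] := band_roots_model m_0 m_n1 charL k_walk k_gt1 k_inj p.
by exists rs; split=> // tau /rs0; rewrite horner_band_poly.
Qed.

End GenericCondition.

(** * Marked vertices and components of the graph *)

Section Marks.
Variables (n : nat) (m : nat -> nat).
Hypotheses (m_0 : m 0%N = 0%N) (m_n1 : m n.+1 = 0%N).
Local Notation vtx := (vertex n m).
Local Notation walk := (@walk n m).
Implicit Types w q p : vtx.

Lemma adjacentE w q : adjacent w q -> fconnect walk w q.
Proof.
have csym := fconnect_sym (walk_inj m_0 m_n1).
rewrite /adjacent !(upper_edge_walk m_0 m_n1) !(lower_edge_walk m_0 m_n1).
case/or4P=> /andP[_ /eqP->]; [rewrite csym| | |rewrite csym]; exact: fconnect1.
Qed.

Lemma adjacent_walk w : adjacent w (walk w).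
Proof.
rewrite /adjacent !(upper_edge_walk m_0 m_n1) !(lower_edge_walk m_0 m_n1) eqxx.
by case: (goes_up w); rewrite ?orbT.
Qed.

(** Every edge is an edge of the walk, in one direction or the other, so undirected components and
    orbits coincide. *)
Lemma connect_adjacentE w q : connect (@adjacent n m) w q = fconnect walk w q.
Proof.
apply/idP/idP; last first.
  by apply: connect_sub => {}w {}q /eqP <-; exact: connect1 (adjacent_walk w).
by apply: connect_sub => {}w {}q; exact: adjacentE.
Qed.

Lemma markedP w : reflect (forall q, fconnect walk w q ->
    (level q < level w)%N \/ level q = level w /\ (pos w <= pos q)%N) (marked w).
Proof.
apply: (iffP forallP) => mw q; have := mw q; rewrite connect_adjacentE.
  by move=> /implyP h /h/orP[|/andP[/eqP]]; [left|right].
by move=> h; apply/implyP=> /h[->//|[-> ->]]; rewrite eqxx orbT.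
Qed.

Lemma marked_unique w q : fconnect walk w q -> marked w -> marked q -> w = q.
Proof.
move=> wq /markedP/(_ _ wq) mw /markedP mq.
have {mq} : (level w < level q)%N \/ level w = level q /\ (pos q <= pos w)%N.
  by apply: mq; rewrite fconnect_sym //; exact: walk_inj.
by move=> mq; apply: vertex_inj; lia.
Qed.

Lemma marked_exists w : exists2 a, marked a & fconnect walk w a.
Proof.
have csym := fconnect_sym (walk_inj m_0 m_n1).
case: (@arg_maxnP _ w (fun q => fconnect walk w q) (fun q => level q) (connect0 _ w)).
move=> w1 ww1 maxw1.
pose A q := fconnect walk w q && (level q == level w1).
have Aw1 : A w1 by rewrite /A ww1 eqxx.
case: (@arg_minnP _ w1 A (fun q => pos q) Aw1) => a /andP[wa /eqP la] mina.
exists a => //; apply/markedP=> q aq.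
have wq : fconnect walk w q by exact: connect_trans wa aq.
have := maxw1 _ wq; rewrite /= -la leq_eqVlt => /orP[/eqP lq|]; last by left.
by right; split=> //; apply: mina; rewrite /A wq lq la eqxx.
Qed.

(** Arriving by a lower edge would mean coming from a level further left, against the choice of the
    mark. So the edge that enters a marked vertex is its marked upper edge. *)
Lemma marked_up w : marked (walk w) -> goes_up w.
Proof.
move=> /markedP mw; apply: contraT => down_w.
have [lw _] := lower_walkP m_0 m_n1 down_w.
have : fconnect walk (walk w) w.
  by rewrite fconnect_sym; [exact: fconnect1|exact: walk_inj].
by move/mw; lia.
Qed.

End Marks.

(** * Rescaling and change of basis to an up-and-down module *)

Section NormalForm.
Variables (n : nat) (m : nat -> nat).
Hypotheses (m_0 : m 0%N = 0%N) (m_n1 : m n.+1 = 0%N).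
Local Notation vtx := (vertex n m).
Local Notation walk := (@walk n m).
Implicit Types w q p : vtx.
Variables (F : fieldType).
Local Notation V := {ffun vtx -> F^o}.
Local Notation rep := (quiver_rep F n (band_dim m)).

Section Rescale.
Variables (u d : vtx -> vtx -> F) (b : vtx -> V) (s : vtx -> F).
Hypothesis s_neq0 : forall w, s w != 0.
Hypothesis step_b : forall w, step u d w (b w) (s w *: b (walk w)).

(** Weights counted from the marked vertex push all scalars of an orbit onto the edge that returns
    to it. This edge is followed against the arrow [u], which explains the inverse of [lambda]. *)
Lemma rescale : exists (c lambda : vtx -> F),
  [/\ forall w, c w != 0, forall w, lambda w != 0 &
   forall w, step u d w (c w *: b w)
     ((if marked (walk w) then (lambda (walk w))^-1 else 1) *: (c (walk w) *: b (walk w)))].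
Proof.
have inj := walk_inj m_0 m_n1; have csym := fconnect_sym inj.
have /fin_all_exists2[mu mark_mu conn_mu] := marked_exists m_0 m_n1.
have muP w a : fconnect walk w a -> marked a -> a = mu w.
  move=> wa ma; apply: (marked_unique m_0 m_n1) => //.
  by apply: connect_trans (conn_mu w); rewrite csym.
have mu_walk w : mu (walk w) = mu w.
  by apply: muP => //; apply: connect_trans (fconnect1 _ _) (conn_mu _).
pose c w := weight s (mu w) (findex walk (mu w) w).
pose lambda w := (weight s w (fingraph.order walk w))^-1.
exists c, lambda; split=> w; rewrite ?invr_neq0 ?weight_neq0 //.
rewrite /c mu_walk; set a := mu w; set k := findex walk a w.
have aw : fconnect walk a w by rewrite csym; exact: conn_mu.
have wE : iter k walk a = w by exact: iter_findex.
have lt_k : (k < fingraph.order walk a)%N by exact: findex_max.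
have := stepZ (weight s a k) (step_b w).
rewrite scalerA -[s w](congr1 s wE) -weightS scalerA.
have [ma|nma] := boolP (marked (walk w)).
  have wa : walk w = a by apply: muP => //; exact: fconnect1.
  have ek : k.+1 = fingraph.order walk a.
    apply/eqP; rewrite eqn_leq lt_k leqNgt; apply/negP => /findex_iter.
    by rewrite iterS wE wa findex0.
  by rewrite wa findex0 weight0 mulr1 /lambda invrK ek.
have lt_k1 : (k.+1 < fingraph.order walk a)%N.
  rewrite ltn_neqAle lt_k andbT; apply/eqP => e; case/negP: nma.
  by rewrite -wE -iterS e iter_order //; exact: mark_mu.
have -> : findex walk a (walk w) = k.+1 by rewrite -{1}wE -iterS findex_iter.
by rewrite mul1r.
Qed.

End Rescale.

Definition level_vertex i (h : (i < n.+1)%N) (r : 'I_(band_dim m i)) : vtx :=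
  Tagged (fun k : 'I_n.+1 => 'I_(band_dim m k)) (r : 'I_(band_dim m (Ordinal h))).

(** A base change is indexed by all of [nat], so the identity fills the levels beyond [n]; matching
    on [idP] provides the bound needed to form vertices. *)
Definition basis_mx (b : vtx -> V) (i : nat) : 'M[F]_(band_dim m i) :=
  match @idP (i < n.+1)%N with
  | ReflectT h => \matrix_(r, s) b (level_vertex h s) (level_vertex h r)
  | ReflectF _ => 1%:M
  end.

Lemma basis_mxE b i (h : (i < n.+1)%N) r s :
  basis_mx b i r s = b (level_vertex h s) (level_vertex h r).
Proof.
rewrite /basis_mx; case: {-}_ / idP => [h'|] //; rewrite mxE.
by congr (b _ _); apply: vertex_inj.
Qed.

Lemma basis_mx_target b (i : 'I_n) r s :
  basis_mx b i r s = b (target_vertex s) (target_vertex r).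
Proof.
have h : (i < n.+1)%N by rewrite ltnS ltnW.
by rewrite (basis_mxE _ h); congr (b _ _); apply: vertex_inj.
Qed.

Lemma basis_mx_source b (i : 'I_n) r s :
  basis_mx b i.+1 r s = b (source_vertex s) (source_vertex r).
Proof.
have h : (i.+1 < n.+1)%N by rewrite ltnS.
by rewrite (basis_mxE _ h); congr (b _ _); apply: vertex_inj.
Qed.

Lemma level_vertexP w i (h : (i < n.+1)%N) : level w = i -> exists r, w = level_vertex h r.
Proof.
move=> lw; have ltw : (pos w < band_dim m i)%N.
  by rewrite /band_dim -lw; have := pos_copos m_0 m_n1 w; lia.
by exists (Ordinal ltw); apply: vertex_inj.
Qed.

Lemma sum_level (R : nmodType) i (h : (i < n.+1)%N) (G : vtx -> R) :
  \sum_(w | level w == i) G w = \sum_r G (level_vertex h r).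
Proof.
have inj : injective (level_vertex h).
  by move=> r r' /(congr1 (@pos n m)) /= /val_inj.
rewrite -(big_imset _ (in2W inj)) /=; apply: eq_bigl => w.
apply/eqP/imsetP => [/(level_vertexP h)[r ->]|[r _ ->] //].
by exists r.
Qed.

Lemma basis_mx_unit (b : vtx -> V) i : (i <= n)%N -> (forall w, supp (level w) (b w)) ->
  (forall c : vtx -> F, \sum_(w | level w == i) c w *: b w = 0 ->
    forall w, level w = i -> c w = 0) ->
  basis_mx b i \in unitmx.
Proof.
move=> le_in suppb freeb; have h : (i < n.+1)%N by [].
rewrite -unitmx_tr -row_free_unit; apply: inj_row_free => v vb.
pose c w := \sum_(s < band_dim m i) (if pos w == s then v 0 s else 0).
have cE r : c (level_vertex h r) = v 0 r.
  rewrite /c (bigD1 r) //= eqxx big1 ?addr0 // => r' ne.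
  by rewrite /pos /= val_eqE eq_sym (negPf ne).
apply/rowP=> r; rewrite -cE mxE; apply: freeb; last by [].
apply/ffunP=> q; rewrite sum_ffunE [RHS]ffunE.
have [lq|lq] := eqVneq (level q) i; last first.
  apply: big1 => w /eqP lw; rewrite ffunE suppb ?scaler0 // lw //.
have [t ->] := level_vertexP h lq.
rewrite (sum_level h); have /rowP/(_ t) := vb; rewrite !mxE => e; rewrite -[RHS]e.
by apply: eq_bigr => s _; rewrite ffunE cE mxE (basis_mxE _ h).
Qed.

Lemma upper_mxE (lambda : vtx -> F) (i : 'I_n) r s : upper_mx lambda i r s =
  if upper_edge (source_vertex s) (target_vertex r)
  then if marked (source_vertex s) then lambda (source_vertex s) else 1 else 0.
Proof. by rewrite mxE. Qed.

(** The comparison is made column by column. If [q] goes up, [u] sends the vector of [walk q] to a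
    multiple of that of [q], and [d] kills the latter; if [q] goes down, [d] sends the vector of [q]
    to that of [walk q], which [u] kills. *)
Lemma normal_form (x : rep) (b : vtx -> V) (lambda : vtx -> F) : in_Rep x ->
  (forall w, lambda w != 0) ->
  (forall w, step (upper_coef x) (lower_coef x) w (b w)
     ((if marked (walk w) then (lambda (walk w))^-1 else 1) *: b (walk w))) ->
  (forall i (c : vtx -> F), \sum_(w | level w == i) c w *: b w = 0 ->
    forall w, level w = i -> c w = 0) ->
  same_GL_orbit (up_and_down_module lambda) x.
Proof.
move=> relx lambda_neq0 step_b freeb.
have inj := walk_inj m_0 m_n1.
have suppb w : supp (level w) (b w) by case: (step_b w).
have unit_g i : (i <= n)%N -> basis_mx b i \in unitmx.
  by move=> le_in; apply: basis_mx_unit => // c; exact: freeb.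
have upE (i : 'I_n) : upper_arrow x i *m basis_mx b i.+1 = basis_mx b i *m upper_mx lambda i.
  apply/matrixP=> r t; rewrite !mxE.
  have -> : \sum_j upper_arrow x i r j * basis_mx b i.+1 j t
      = appl (upper_coef x) (b (source_vertex t)) (target_vertex r).
    rewrite ffunE (appl_arrow_coef m_0 m_n1); apply: eq_bigr => j _.
    by rewrite basis_mx_source.
  have [q qE] : exists q, source_vertex t = walk q.
    by exists (finv walk (source_vertex t)); rewrite f_finv.
  under [RHS]eq_bigr => j _ do
    rewrite basis_mx_target upper_mxE qE upper_edge_walk // (inj_eq inj).
  have [_ _] := step_b q; rewrite qE; case: ifPn => [up_q|down_q] e; last first.
    rewrite big1 => [|j _]; last first.
      case: ifP; rewrite ?mulr0 // => /andP[up_j /eqP qj].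
      by rewrite qj up_j in down_q.
    have nm : ~~ marked (walk q) by apply: contra down_q; exact: marked_up.
    move: e; rewrite (negPf nm) scale1r => ->.
    by rewrite upper_lower0 // ffunE.
  have lq : level q = i.
    have [lw _] := upper_walkP m_0 m_n1 up_q; rewrite -qE in lw.
    by apply: succn_inj; rewrite -lw.
  have [j0 q0] := @target_vertexP _ _ m_0 m_n1 q i lq.
  rewrite (bigD1 j0) //= big1 ?addr0 => [|j ne]; last first.
    rewrite ifN ?mulr0 //; apply: contra ne => /andP[_ /eqP].
    rewrite q0 => e'; apply/eqP/val_inj.
    by have := congr1 (@pos n m) e'; rewrite /pos.
  rewrite -q0 up_q eqxx /= e applZ [in RHS]ffunE.
  case: ifP => _; last by rewrite scale1r mulr1.
  by rewrite -[_ *: _]/(_ * _) mulrAC mulVf ?mul1r.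
have loE (i : 'I_n) : lower_arrow x i *m basis_mx b i.+1 = basis_mx b i *m @lower_mx n m F i.
  apply/matrixP=> r t; rewrite !mxE.
  have -> : \sum_j lower_arrow x i r j * basis_mx b i.+1 j t
      = appl (lower_coef x) (b (source_vertex t)) (target_vertex r).
    rewrite ffunE (appl_arrow_coef m_0 m_n1); apply: eq_bigr => j _.
    by rewrite basis_mx_source.
  have [q qE] : exists q, source_vertex t = q by exists (source_vertex t).
  under [RHS]eq_bigr => j _ do rewrite basis_mx_target mxE qE lower_edge_walk //.
  rewrite qE.
  have [_ _] := step_b q; case: ifPn => [up_q|down_q] e.
    rewrite big1 => [|j _]; last by rewrite mulr0.
    by rewrite e lower_upper0 // ffunE.
  have lq : level (walk q) = i.
    by have [lw _] := lower_walkP m_0 m_n1 down_q; apply: succn_inj; rewrite -lw -qE.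
  have [j0 q0] := @target_vertexP _ _ m_0 m_n1 (walk q) i lq.
  rewrite (bigD1 j0) //= big1 ?addr0 => [|j ne]; last first.
    rewrite ifN ?mulr0 //; apply: contra ne => /eqP; rewrite q0 => e'.
    by apply/eqP/val_inj; have := congr1 (@pos n m) e'; rewrite /pos.
  rewrite -q0 eqxx /= mulr1 -e.
  by rewrite ifN ?scale1r //; apply: contra down_q; exact: marked_up.
exists (basis_mx b); split=> // i.
have ui : basis_mx b i.+1 \in unitmx by exact: unit_g.
have := upE i; have := loE i; rewrite /upper_arrow /lower_arrow /=.
by case: (odd _) => lo up; rewrite -lo -up !mulmxK.
Qed.

End NormalForm.

(** * Generic representations lie in orbits of up-and-down modules *)

Section Orbit.
Variables (L : closedFieldType) (n : nat) (m : nat -> nat).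
Hypotheses (m_0 : m 0%N = 0%N) (m_n1 : m n.+1 = 0%N).
Hypothesis charL : [pchar L] =i pred0.

Lemma generic_same_orbit (x : quiver_rep L n (band_dim m)) : in_Rep x ->
  (forall p, generic_at m_0 m_n1 x p) ->
  exists2 lambda : vertex n m -> L, up_and_down_scalars lambda
    & same_GL_orbit (up_and_down_module lambda) x.
Proof.
move=> relx gen_x.
have regular p : exists2 D : {poly L}, D != 0 & forall tau, D.[tau] != 0 ->
    band_det m_0 m_n1 (upper_coef x) (lower_coef x) tau p != 0.
  have [D1 _] := gen_x p; exists (band_poly m_0 m_n1 x p).
    by apply: contraNneq D1 => ->; rewrite horner0.
  by move=> tau; rewrite horner_band_poly.
have roots p : exists rs : seq L, [/\ uniq rs, size rs = class_size m_0 m_n1 p &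
    {in rs, forall tau, band_det m_0 m_n1 (upper_coef x) (lower_coef x) tau p = 0
       /\ tau != 0}].
  have [_ [rs [uniq_rs size_rs rs0]]] := gen_x p; exists rs; split=> // tau /rs0.
  by rewrite horner_band_poly.
have [b [s [s_neq0 step_b free_b]]] := band_basis charL
  (@arrow_coef_level _ _ _ (upper_arrow x)) (@arrow_coef_level _ _ _ (lower_arrow x))
  (lower_upper0 m_0 m_n1 relx) regular roots.
have [c [lambda [c_neq0 lambda_neq0 step_cb]]] := rescale m_0 m_n1 s_neq0 step_b.
exists lambda; first by move=> w _; exact: lambda_neq0.
apply: (normal_form m_0 m_n1 relx lambda_neq0 step_cb) => i a sum0 w lw.
have /eqP : a w * c w = 0.
  apply: (free_b i (fun w => a w * c w)) => //; rewrite -[RHS]sum0.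
  by apply: eq_bigr => q _; rewrite scalerA.
by rewrite mulf_eq0 (negPf (c_neq0 w)) orbF => /eqP.
Qed.

End Orbit.

Local Close Scope ring_scope.

Theorem theoremA (K : fieldType) (charK0 : [pchar K]%R =i pred0)
    (L : closedFieldType) (iota : {rmorphism K -> L})
    (n : nat) (n_ge1 : 1 <= n)
    (m : nat -> nat) (m_0 : m 0 = 0) (m_n1 : m n.+1 = 0) :
  exists U : quiver_rep L n (band_dim m) -> Prop,
    [/\ zariski_open_in iota (@band_component L n m) U,
        exists x, U x
      & forall x, U x ->
          exists2 lambda : vertex n m -> L,
            up_and_down_scalars lambda
            & same_GL_orbit (up_and_down_module lambda) x].
Proof.
have charL : [pchar L]%R =i pred0 by move=> p; rewrite (fmorph_pchar iota).
have [x0 x0R gen_x0] := @generic_point L n m m_0 m_n1 charL.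
have [D D_x0 genD] := generic_open iota charL gen_x0.
(* The open set is the trace on the component of one principal open set, and the model is a point of
   it. *)
exists (fun x => band_component x /\ (poly_eval iota D x != 0)%R); split.
- exists (eq D) => x; split=> [[xR D_x]|[xR [p <-]]]; split=> //; by exists D.
- by exists x0.
by move=> x [[relx _] D_x]; apply: generic_same_orbit relx (genD x D_x).
Qed.
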